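(* Let $\mathcal{G}=(G,(G_j)_{1\le j\le m},(\phi_j)_{1\le j\le m})$ be any Abelian group HBL datum. For every $s\in\mathcal{P}(\mathcal{G})$, $$\mathbb{B}(\mathcal{G},s)=\mathbb{A}(\mathcal{G},s)$$ (as elements of $[0,\infty]$). Conversely, if $s\in[0,1]^m$ and if there exists $C<\infty$ such that $$|E|\le C\prod_{j=1}^m|\phi_j(E)|^{s_j}$$ for all nonempty finite subsets $E\subset G$, then $s\in\mathcal{P}(\mathcal{G})$ and $C\ge\mathbb{A}(\mathcal{G},s)$.
   Context: An Abelian group HBL datum is a tuple $\mathcal{G}=(G,(G_j)_{1\le j\le m},(\phi_j)_{1\le j\le m})$ where $m$ is a positive integer, $G$ and $G_j$ are Abelian groups (not assumed finite or finitely generated), and $\phi_j:G\to G_j$ are group homomorphisms. All groups are discrete and all norms are with respect to counting measure: $\|f\|_{p}=(\sum_x |f(x)|^p)^{1/p}$ for $p\in[1,\infty)$ and $\|f\|_\infty=\sup_x|f(x)|$; when $s_j=0$, $1/s_j=\infty$. $|E|$ denotes the number of elements of a set $E$, and $H\le G$ means that $H$ is a subgroup of $G$. For a finite subgroup $H\le G$ and $s\in[0,1]^m$, define $A(H,s)=|H|\prod_{j=1}^m|\phi_j(H)|^{-s_j}$, and define $\mathbb{A}(\mathcal{G},s)=\sup_{H} A(H,s)\in[1,\infty]$, the supremum being over all finite subgroups $H$ of $G$. $\mathbb{B}(\mathcal{G},s)\in[0,\infty]$ is the infimum of the set of all $C\le\infty$ such that $\sum_{x\in G}\prod_{j=1}^m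 f_j(\phi_j(x))\le C\prod_{j=1}^m\|f_j\|_{1/s_j}$ for all nonnegative functions $f_j\in L^{1/s_j}(G_j)$. $\mathcal{P}(\mathcal{G})$ is the set of all $s\in[0,1]^m$ such that $\operatorname{Rank}(H)\le\sum_{j=1}^m s_j\operatorname{Rank}(\phi_j(H))$ for every subgroup $H\le G$ of finite rank, where $\operatorname{Rank}$ is the usual (torsion-free) rank of an Abelian group. *)

(* Defs.v *)
From HB Require Import structures.
From mathcomp Require Import all_boot all_order all_algebra finmap.
From mathcomp Require Import all_classical all_reals all_analysis.

Set Implicit Arguments.
Unset Strict Implicit.
Unset Printing Implicit Defensive.

Import Order.TTheory GRing.Theory Num.Theory.

Local Open Scope classical_set_scope.
Local Open Scope ring_scope.

Record hbl_datum : Type := HBLDatum {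
  hbl_size : nat;
  hbl_size_gt0 : (0 < hbl_size)%N;
  hbl_dom : zmodType;
  hbl_cod : 'I_hbl_size -> zmodType;
  hbl_map : forall j : 'I_hbl_size, {additive hbl_dom -> hbl_cod j}
}.

Definition is_subgroup (G : zmodType) (H : set G) : Prop :=
  GRing.zmod_closed (mem H).

(* Meaningful for finite A only: fset_set sends infinite sets to fset0. *)
Definition set_card (T : choiceType) (A : set T) : nat := #|` fset_set A|.

Definition lin_indep (G : zmodType) (n : nat) (x : 'I_n -> G) : Prop :=
  forall c : 'I_n -> int, \sum_(i < n) x i *~ c i = 0 -> forall i, c i = 0.

(* Torsion-free rank: supremum of the sizes of finite Z-linearly independent
   families in H; equal to +oo whenever the rank is infinite. *)
Definition rank (R : realType) (G : zmodType) (H : set G) : \bar R :=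
  ereal_sup [set (n%:R)%:E | n in
    [set n : nat | exists x : 'I_n -> G, (forall i, H (x i)) /\ lin_indep x]].

(* The norm of L^p for the counting measure, used for 1 <= p <= +oo. *)
Definition lpnorm (R : realType) (T : choiceType) (p : \bar R) (f : T -> R)
    : \bar R :=
  match p with
  | q%:E => poweR (esum [set: T] (fun x => (`|f x| `^ q)%:E)) q^-1
  | _ => ereal_sup [set (`|f x|)%:E | x in [set: T]]
  end.

Definition in_unit_cube (R : realType) (m : nat) (s : 'I_m -> R) : Prop :=
  forall j, 0 <= s j <= 1.

Section HBLConstants.
Variables (R : realType) (D : hbl_datum) (s : 'I_(hbl_size D) -> R).

Definition hbl_ratio (H : set (hbl_dom D)) : R :=
  (set_card H)%:R *
  \prod_(j < hbl_size D) (set_card (hbl_map j @` H))%:R `^ (- s j).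

Definition hbl_A : \bar R :=
  ereal_sup [set (hbl_ratio H)%:E | H in
    [set H : set (hbl_dom D) | is_subgroup H /\ finite_set H]].

(* In \bar R the inverse of 0 is +oo, so ((s j)%:E)^-1 is the exponent 1/s_j
   also when s j = 0. *)
Definition hbl_exponent (j : 'I_(hbl_size D)) : \bar R := ((s j)%:E^-1)%E.

Definition hbl_inequality (C : \bar R) : Prop :=
  forall f : forall j, hbl_cod j -> R,
    (forall j y, 0 <= f j y) ->
    (forall j, (lpnorm (hbl_exponent j) (f j) < +oo)%E) ->
    (esum [set: hbl_dom D]
       (fun x => (\prod_(j < hbl_size D) f j (hbl_map j x))%:E)
     <= C * \prod_(j < hbl_size D) lpnorm (hbl_exponent j) (f j))%E.

Definition hbl_B : \bar R :=
  ereal_inf [set C : \bar R | (0 <= C)%E /\ hbl_inequality C].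

Definition hbl_P : Prop :=
  in_unit_cube s /\
  forall H : set (hbl_dom D), is_subgroup H -> (rank R H < +oo)%E ->
    (rank R H <=
     \sum_(j < hbl_size D) (s j)%:E * rank R (hbl_map j @` H))%E.

End HBLConstants.

(* Main.v *)
Require Import Defs.
From HB Require Import structures.
From mathcomp Require Import all_boot all_order all_algebra.
From mathcomp Require Import all_classical all_reals all_analysis.
From mathcomp Require Import ring lra zify.

Set Implicit Arguments.
Unset Strict Implicit.
Unset Printing Implicit Defensive.

Import Order.TTheory GRing.Theory Num.Theory.

Local Open Scope classical_set_scope.
Local Open Scope ring_scope.

(** Testing the inequality on the indicator functions of [phi_j H], for [H] a
    finite subgroup, shows that no constant below [A(H, s)] is admissible.  The
    main point is the converse: if [s] lies in [P] and all ratios [A(H, s)] are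
    at most [A], then the inequality holds with constant [A].

    Put [u_j = f_j ^ (1/s_j)].  By monotone convergence it suffices to bound
    [sum_(x in E) prod_j u_j(phi_j x) ^ s_j] by
    [A * prod_j (sum_y u_j(y)) ^ s_j] for finite sets [E] ([hbl_seq]).  In this
    form two facts are elementary.  By Hoelder the best constant is log-convex
    in [s] ([hbl_seq_interpolation]).  By Fubini constants multiply along
    fibrations ([hbl_seq_fibration]); in particular the constant of [H / N] is
    at most the product of those of [M / N] and [H / M], for [N <= M <= H].

    Consider a family of subgroups with a notion of size [l], and call
    [l(M) - l(N) - sum_j s_j (l(phi_j M) - l(phi_j N))] the excess of [M] over
    [N].  If the excess over [N] is at most [c] for all [M] between [N] and [H],
    then [H / N] satisfies the inequality with constant [exp c]
    ([lattice_section_hbl]).  The proof is by induction.  If some [M] strictly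
    between [N] and [H] has excess [c], then the section splits there, with
    constants [exp c] and 1.  If some [s_j] is 1, the sum over the fibres of
    [phi_j] reduces [H] to a kernel ([section_hbl_kernel]).  Otherwise, if two
    exponents are strictly between 0 and 1, they are moved in opposite
    directions so that the excess of [H] does not change, until one of the
    previous cases or an exponent 0 occurs at both ends of a segment, and the
    inequality at [s] follows by interpolation.  What remains is the case of a
    single exponent.

    This is applied twice: to finite groups, with [l] the logarithm of the
    cardinality, where [exp c] becomes the largest ratio [A(H, s)]
    ([finite_subgroup_hbl]), and to vector spaces over the rationals, with [l]
    the dimension and [c = 0] ([rational_hbl]).  For an arbitrary group, a
    maximal independent subset of [E] assigns rational coordinates to the
    elements of [E].  Elements with the same coordinates differ by torsion, so
    they lie in a coset of a finite subgroup, and the rank condition for [G]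
    becomes the dimension condition for the coordinate space; the two cases are
    combined by one more fibration ([abelian_hbl_seq]).

    For the second assertion, a box of side [N] spanned by [r] independent
    elements of [H] has [N ^ r] elements, while its image under [phi_j] has at
    most a constant times [N ^ rank (phi_j H)] elements
    ([set_card_image_box]); letting [N] grow gives the rank condition, and
    taking [E = H] finite gives [C >= A]. *)

(** * Finite sums and powers *)

Section FiniteSums.
Variable R : realType.

Lemma sum_fibres (X Z : eqType) (E : seq X) (pi : X -> Z) (F : X -> R) :
  \sum_(x <- E) F x =
  \sum_(z <- undup (map pi E)) \sum_(x <- [seq x <- E | pi x == z]) F x.
Proof.
under [RHS]eq_bigr do rewrite big_filter.
rewrite (exchange_big_dep xpredT) //= [LHS]big_seq [RHS]big_seq.
apply: eq_bigr => x xE.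
rewrite -big_filter.
rewrite (eq_filter (a2 := pred1 (pi x))) => [|z /=]; last exact: eq_sym.
by rewrite filter_pred1_uniq ?undup_uniq// ?mem_undup ?map_f// big_seq1.
Qed.

Lemma sum_sub_le (X : eqType) (r1 r2 : seq X) (F : X -> R) :
  uniq r1 -> uniq r2 -> {subset r1 <= r2} ->
  (forall x, 0 <= F x) -> \sum_(x <- r1) F x <= \sum_(x <- r2) F x.
Proof.
move=> u1 u2 sub F0.
rewrite (perm_big [seq x <- r2 | x \in r1]).
  by rewrite big_filter [leRHS](bigID (mem r1)) /= lerDl sumr_ge0.
apply: uniq_perm => //; first exact: filter_uniq.
move=> x; rewrite mem_filter andb_idr//; exact: sub.
Qed.

Lemma sum_le_one (X : eqType) (r : seq X) (Q : pred X) (w0 : X) (a : R) :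
  uniq r -> 0 <= a -> (forall w, Q w -> w = w0) ->
  \sum_(w <- r | Q w) a <= a.
Proof.
move=> ur a0 Qw.
apply: (@le_trans _ _ (\sum_(w <- [:: w0]) a)); last by rewrite big_seq1.
rewrite -big_filter; apply: sum_sub_le => //; first exact: filter_uniq.
by move=> w; rewrite mem_filter inE => /andP[/Qw -> _].
Qed.

Lemma powRD_ge0 (x a b : R) : 0 <= a -> 0 <= b ->
  x `^ (a + b) = x `^ a * x `^ b.
Proof.
move=> a0 b0; have [ab0|ab0] := eqVneq (a + b) 0; last first.
  by rewrite powRD // (negbTE ab0).
have -> : a = 0 by apply/eqP; rewrite eq_le a0 -ab0 lerDl b0.
have -> : b = 0 by apply/eqP; rewrite eq_le b0 -ab0 lerDr a0.
by rewrite addr0 powRr0 mulr1.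
Qed.

Lemma powR_prod (I : Type) (r : seq I) (F : I -> R) (t : R) :
  (forall i, 0 <= F i) ->
  (\prod_(i <- r) F i) `^ t = \prod_(i <- r) F i `^ t.
Proof.
move=> F0; elim: r => [|i r IH]; first by rewrite !big_nil powR1.
by rewrite !big_cons powRM ?IH// prodr_ge0.
Qed.

Lemma weighted_amgm (a b t : R) : 0 <= a -> 0 <= b -> 0 <= t <= 1 ->
  a `^ (1 - t) * b `^ t <= (1 - t) * a + t * b.
Proof.
move=> a0 b0 /andP[t0 t1].
have [->|tn0] := eqVneq t 0.
  by rewrite subr0 powRr1// powRr0 mulr1 mul1r mul0r addr0.
have [->|tn1] := eqVneq t 1.
  by rewrite subrr powRr0 powRr1// !mul1r mul0r add0r.
have tp : 0 < t by rewrite lt_def tn0.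
have t1p : 0 < 1 - t by rewrite subr_gt0 lt_def eq_sym tn1.
have := @conjugate_powR R (a `^ (1 - t)) (b `^ t) (1 - t)^-1 t^-1.
rewrite !invrK -!powRrM !mulfV ?gt_eqF// !powRr1// [_ * a]mulrC [_ * b]mulrC.
by apply; rewrite ?powR_ge0 ?invr_gt0 ?subrK.
Qed.

Lemma hoelder_seq (X : Type) (E : seq X) (a b : X -> R) (t : R) :
  0 <= t <= 1 -> (forall x, 0 <= a x) -> (forall x, 0 <= b x) ->
  \sum_(x <- E) a x `^ (1 - t) * b x `^ t <=
  (\sum_(x <- E) a x) `^ (1 - t) * (\sum_(x <- E) b x) `^ t.
Proof.
move=> t01 a0 b0.
have [->|tn0] := eqVneq t 0.
  rewrite subr0 powRr0 mulr1 powRr1 ?sumr_ge0//.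
  by apply: ler_sum => x _; rewrite powRr0 mulr1 powRr1.
have [->|tn1] := eqVneq t 1.
  rewrite subrr powRr0 mul1r powRr1 ?sumr_ge0//.
  by apply: ler_sum => x _; rewrite powRr0 mul1r powRr1.
have /andP[t0 t1] := t01.
have tn1' : 1 - t != 0 by rewrite subr_eq0 eq_sym.
set A := \sum_(x <- E) a x; set B := \sum_(x <- E) b x.
have A0 : 0 <= A by rewrite sumr_ge0.
have B0 : 0 <= B by rewrite sumr_ge0.
have rhs0 : 0 <= A `^ (1 - t) * B `^ t by rewrite mulr_ge0 ?powR_ge0.
have [Az|An] := eqVneq A 0.
  rewrite (le_trans _ rhs0)//.
  move: Az; rewrite /A; elim: (E) => [|x r IH]; first by rewrite !big_nil.
  rewrite !big_cons => /eqP.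
  rewrite paddr_eq0 ?sumr_ge0// => /andP[/eqP-> /eqP /IH].
  by rewrite powR0// mul0r add0r.
have [Bz|Bn] := eqVneq B 0.
  rewrite (le_trans _ rhs0)//.
  move: Bz; rewrite /B; elim: (E) => [|x r IH]; first by rewrite !big_nil.
  rewrite !big_cons => /eqP.
  rewrite paddr_eq0 ?sumr_ge0// => /andP[/eqP-> /eqP /IH].
  by rewrite powR0// mulr0 add0r.
have Ap : 0 < A by rewrite lt_def An.
have Bp : 0 < B by rewrite lt_def Bn.
(* normalise both sums to 1 and apply the weighted mean inequality termwise *)
have -> : \sum_(x <- E) a x `^ (1 - t) * b x `^ t =
  A `^ (1 - t) * B `^ t *
  \sum_(x <- E) (a x / A) `^ (1 - t) * (b x / B) `^ t.
  rewrite mulr_sumr; apply: eq_bigr => x _.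
  rewrite mulrACA -!powRM ?divr_ge0//.
  by rewrite [A * _]mulrC [B * _]mulrC !divfK.
rewrite -[leRHS]mulr1 ler_wpM2l//.
apply: (@le_trans _ _ (\sum_(x <- E) ((1 - t) * (a x / A) + t * (b x / B)))).
  by apply: ler_sum => x _; apply: weighted_amgm; rewrite ?divr_ge0.
rewrite big_split /= -!mulr_sumr -!mulr_suml -/A -/B !mulfV// !mulr1.
by rewrite subrK.
Qed.

End FiniteSums.

(** * Hoelder-Brascamp-Lieb inequalities over finite families *)

Section HblSeq.
Variables (R : realType) (m : nat).

(** The inequality in the variables [u_j = f_j ^ (1/s_j)], which makes it
    log-convex in [s].  Only the labels [p j x] matter, so no group structure
    is required. *)
Definition hbl_seq (X : eqType) (Y : 'I_m -> eqType) (s : 'I_m -> R)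
    (E : seq X) (p : forall j, X -> Y j) (C : R) : Prop :=
  forall u : forall j, Y j -> R, (forall j y, 0 <= u j y) ->
  \sum_(x <- E) \prod_(j < m) u j (p j x) `^ s j <=
  C * \prod_(j < m) (\sum_(y <- undup (map (p j) E)) u j y) `^ s j.

Lemma prod_powR_le (u v s : 'I_m -> R) : (forall j, 0 <= s j) ->
  (forall j, 0 <= u j <= v j) ->
  \prod_(j < m) u j `^ s j <= \prod_(j < m) v j `^ s j.
Proof.
move=> s0 uv; apply: ler_prod => j _; have /andP[u0 le_uv] := uv j.
rewrite powR_ge0 /=; apply: ge0_ler_powR => //; rewrite nnegrE//.
exact: le_trans le_uv.
Qed.

Lemma hbl_seq_le (X : eqType) (Y : 'I_m -> eqType) s (E : seq X)
    (p : forall j, X -> Y j) (C C' : R) :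
  C <= C' -> hbl_seq s E p C -> hbl_seq s E p C'.
Proof.
move=> CC' h u u0; apply: le_trans (h u u0) _.
by rewrite ler_wpM2r// prodr_ge0// => j _; rewrite powR_ge0.
Qed.

(** Fubini: sum first over the fibres of [pi] and then over its image; the
    partial sums of [u_j] over the fibres are the weights on the base.  The
    compatibility hypothesis says that each label [p j x] determines a label
    of the base, so that no value of [u_j] is counted twice. *)
Lemma hbl_seq_fibration (X Z : eqType) (Y W : 'I_m -> eqType) s (E : seq X)
    (p : forall j, X -> Y j) (pi : X -> Z) (q : forall j, Z -> W j)
    (C1 C2 : R) :
  (forall j, 0 <= s j) -> 0 <= C1 -> 0 <= C2 ->
  (forall j, {in E &, forall x x', p j x = p j x' ->
     q j (pi x) = q j (pi x')}) ->
  (forall z, z \in map pi E -> hbl_seq s [seq x <- E | pi x == z] p C1) ->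
  hbl_seq s (undup (map pi E)) q C2 ->
  hbl_seq s E p (C1 * C2).
Proof.
move=> s0 C10 C20 compat fib base u u0.
pose over j (w : W j) y :=
  y \in map (p j) [seq x <- E | q j (pi x) == w].
pose u' j (w : W j) := \sum_(y <- undup (map (p j) E) | over j w y) u j y.
have u'0 j w : 0 <= u' j w by rewrite sumr_ge0.
rewrite (sum_fibres _ pi).
apply: (@le_trans _ _ (C1 * \sum_(z <- undup (map pi E))
    \prod_(j < m) u' j (q j z) `^ s j)).
  rewrite mulr_sumr [leLHS]big_seq [leRHS]big_seq; apply: ler_sum => z.
  rewrite mem_undup => zE; apply: le_trans (fib z zE u u0) _.
  rewrite ler_wpM2l//; apply: prod_powR_le => // j; rewrite sumr_ge0//=.
  rewrite /u' -[leRHS]big_filter.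
  apply: sum_sub_le; rewrite ?filter_uniq ?undup_uniq//.
  move=> y; rewrite mem_undup mem_filter mem_undup => /mapP[x].
  rewrite mem_filter => /andP[/eqP xz xE] ->.
  rewrite map_f// andbT; apply: map_f; by rewrite mem_filter xz eqxx.
rewrite -mulrA ler_wpM2l//; apply: le_trans (base _ u'0) _.
have le_prod : \prod_(j < m)
    (\sum_(w <- undup (map (q j) (undup (map pi E)))) u' j w) `^ s j <=
  \prod_(j < m) (\sum_(y <- undup (map (p j) E)) u j y) `^ s j.
  apply: prod_powR_le => // j; rewrite sumr_ge0//= /u'.
  rewrite (exchange_big_dep xpredT)//= [leLHS]big_seq [leRHS]big_seq.
  apply: ler_sum => y; rewrite mem_undup => /mapP[x0 x0E y0].
  apply: (sum_le_one (w0 := q j (pi x0))) => //; first exact: undup_uniq.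
  move=> w /mapP[x]; rewrite mem_filter => /andP[/eqP <- xE] yx.
  by apply: compat => //; rewrite -yx.
exact: ler_wpM2l.
Qed.

Lemma hbl_seq_small (X : eqType) (Y : 'I_m -> eqType) s (E : seq X)
    (p : forall j, X -> Y j) : (size E <= 1)%N -> hbl_seq s E p 1.
Proof.
case: E => [|x [|//]] _ u u0; rewrite mul1r.
  by rewrite big_nil prodr_ge0// => j _; rewrite powR_ge0.
by rewrite big_seq1; under [leRHS]eq_bigr do rewrite big_seq1.
Qed.

(** A fibration with singleton fibres. *)
Lemma hbl_seq_transport (X Z : eqType) (Y W : 'I_m -> eqType) s (E : seq X)
    (p : forall j, X -> Y j) (tau : X -> Z) (q : forall j, Z -> W j) (C : R) :
  (forall j, 0 <= s j) -> 0 <= C -> uniq E -> {in E &, injective tau} ->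
  (forall j, {in E &, forall x x', p j x = p j x' ->
     q j (tau x) = q j (tau x')}) ->
  hbl_seq s (map tau E) q C -> hbl_seq s E p C.
Proof.
move=> s0 C0 uE inj compat base; rewrite -[C]mul1r.
apply: (hbl_seq_fibration (pi := tau) (q := q)) => //; last first.
  by rewrite undup_id// map_inj_in_uniq.
move=> z /mapP[x xE ->]; apply: hbl_seq_small.
apply: (@uniq_leq_size _ _ [:: x]); first by rewrite filter_uniq.
by move=> y; rewrite mem_filter inE => /andP[/eqP e yE]; apply/eqP/inj.
Qed.

(** The optimal constant is log-convex in the exponents: the summand for a
    mixture of exponents is a mixture of the summands, and Hoelder applies. *)
Lemma hbl_seq_interpolation (X : eqType) (Y : 'I_m -> eqType)
    (s s0 s1 : 'I_m -> R) (E : seq X) (p : forall j, X -> Y j)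
    (t C0 C1 : R) :
  (forall j, 0 <= s0 j) -> (forall j, 0 <= s1 j) -> 0 <= t <= 1 ->
  (forall j, s j = (1 - t) * s0 j + t * s1 j) ->
  0 <= C0 -> 0 <= C1 -> hbl_seq s0 E p C0 -> hbl_seq s1 E p C1 ->
  hbl_seq s E p (C0 `^ (1 - t) * C1 `^ t).
Proof.
move=> s00 s10 t01 sE C00 C10 h0 h1 u u0.
have /andP[t0 t1] := t01; have t1' : 0 <= 1 - t by rewrite subr_ge0.
have mix (v : 'I_m -> R) : (forall j, 0 <= v j) ->
    \prod_(j < m) v j `^ s j =
    (\prod_(j < m) v j `^ s0 j) `^ (1 - t) *
    (\prod_(j < m) v j `^ s1 j) `^ t.
  move=> v0; rewrite !powR_prod; try by move=> j; exact: powR_ge0.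
  rewrite -big_split /=; apply: eq_bigr => j _.
  rewrite -!powRrM sE powRD_ge0 ?mulr_ge0//.
  by rewrite ![_ * t]mulrC ![_ * (1 - t)]mulrC.
under eq_bigr do rewrite mix//.
rewrite mix => [|j]; last by rewrite sumr_ge0.
have pos (r : 'I_m -> R) (v : 'I_m -> R) : 0 <= \prod_(j < m) v j `^ r j.
  by rewrite prodr_ge0// => j _; rewrite powR_ge0.
apply: le_trans (hoelder_seq _ t01 _ _) _ => //.
rewrite mulrACA -!powRM//; apply: ler_pM; rewrite ?powR_ge0//.
  apply: ge0_ler_powR => //; rewrite ?nnegrE ?mulr_ge0 ?sumr_ge0//.
  exact: h0.
apply: ge0_ler_powR => //; rewrite ?nnegrE ?mulr_ge0 ?sumr_ge0//.
exact: h1.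
Qed.

End HblSeq.

(** * Sections of an Abelian group *)

Section Subgroups.
Variable V : zmodType.
Implicit Types (S : set V) (x y : V).

Lemma subgroupP S : is_subgroup S <->
  S 0 /\ (forall x y, S x -> S y -> S (x - y)).
Proof.
split=> [[S0 SB]|[S0 SB]]; split.
- by have := S0; rewrite inE.
- by move=> x y Sx Sy; have := SB x y; rewrite !inE; apply.
- by rewrite inE.
- by move=> x y; rewrite !inE; exact: SB.
Qed.

Lemma subgroup0 S : is_subgroup S -> S 0.
Proof. by case/subgroupP. Qed.

Lemma subgroupB S x y : is_subgroup S -> S x -> S y -> S (x - y).
Proof. by case/subgroupP => _; apply. Qed.

Lemma subgroupN S x : is_subgroup S -> S x -> S (- x).
Proof.
by move=> hS Sx; rewrite -sub0r; apply: subgroupB => //; exact: subgroup0.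
Qed.

Lemma subgroupD S x y : is_subgroup S -> S x -> S y -> S (x + y).
Proof.
move=> hS Sx Sy; rewrite -[y]opprK; apply: subgroupB => //.
exact: subgroupN.
Qed.

(** A choice of representatives for the cosets of [S]; cosets are handled
    through these, so that no quotient group has to be formed. *)
Definition rep S x : V := xget 0 [set y | S (y - x)].

Lemma repB S x : is_subgroup S -> S (rep S x - x).
Proof.
move=> hS; have : [set y | S (y - x)] (rep S x); last by [].
by apply: xgetPex; exists x => /=; rewrite subrr; exact: subgroup0.
Qed.

Lemma rep_eqP S x y : is_subgroup S -> rep S x = rep S y <-> S (x - y).
Proof.
move=> hS; split=> [e|Sxy].
  have -> : x - y = (rep S y - y) - (rep S x - x).
    by rewrite e opprB [RHS]addrC subrKA.
  by apply: subgroupB => //; exact: repB.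
congr (xget 0 _); apply/seteqP; split=> z /= Sz.
  by rewrite -(subrKA x); apply: subgroupD.
by rewrite -(subrKA y) -[y - x]opprB; apply: subgroupB.
Qed.

Lemma rep_id S x : is_subgroup S -> rep S (rep S x) = rep S x.
Proof. by move=> hS; apply/rep_eqP => //; exact: repB. Qed.

End Subgroups.

Lemma subgroup_image (V W : zmodType) (f : {additive V -> W}) (S : set V) :
  is_subgroup S -> is_subgroup (f @` S).
Proof.
move=> hS; apply/subgroupP; split.
  by exists 0; [exact: subgroup0|rewrite raddf0].
move=> _ _ [x Sx <-] [y Sy <-]; exists (x - y); rewrite ?raddfB//.
exact: subgroupB.
Qed.

Section Sections.
Variables (R : realType) (m : nat) (G : zmodType) (Gj : 'I_m -> zmodType).
Variable phi : forall j, {additive G -> Gj j}.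
Implicit Types (N M H : set G) (s : 'I_m -> R).

(** [x] modulo [N], seen in the quotient of [Gj j] by the image of [N]. *)
Definition label N j (x : G) : Gj j := rep (phi j @` N) (phi j x).

(** The inequality for the quotient group [H / N], mapping to the quotients of
    the [Gj j] by the images of [N]. *)
Definition section_hbl N H s (C : R) : Prop :=
  forall E : seq G, uniq E -> (forall x, x \in E -> H x) ->
  {in E &, forall x y, N (x - y) -> x = y} ->
  hbl_seq s E (label N) C.

Lemma label_eqP N j x y : is_subgroup N ->
  label N j x = label N j y <-> (phi j @` N) (phi j (x - y)).
Proof. by move=> hN; rewrite raddfB; apply: rep_eqP; exact: subgroup_image. Qed.

(** The label is a function of [phi j x], hence coarser. *)
Lemma hbl_seq_of_label N s C (E : seq G) :
  (forall j, 0 <= s j) -> 0 <= C -> uniq E ->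
  hbl_seq s E (label N) C -> hbl_seq s E (fun j x => phi j x) C.
Proof.
move=> s0 C0 uE; rewrite -[E in hbl_seq _ E (label N)]map_id => h.
by apply: hbl_seq_transport h => // j x y _ _; rewrite /label => ->.
Qed.

(** Translation by [- x0] is compatible with the labels, because [phi j] is
    additive. *)
Lemma section_hbl_translate N M s C (E : seq G) x0 : is_subgroup N ->
  (forall j, 0 <= s j) -> 0 <= C -> section_hbl N M s C ->
  uniq E -> {in E &, forall x y, N (x - y) -> x = y} ->
  (forall x, x \in E -> M (x - x0)) -> hbl_seq s E (label N) C.
Proof.
move=> hN s0 C0 hM uE sep ME.
have inj : injective (fun x : G => x - x0) by exact: addIr.
have diff x y : x - x0 - (y - x0) = x - y by rewrite opprB subrKA.
apply: (hbl_seq_transport (tau := fun x => x - x0) (q := label N)) => //.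
- by move=> x y _ _ /inj.
- move=> j x y _ _ /label_eqP e; apply/label_eqP => //.
  by rewrite diff; exact: e.
apply: hM; first by rewrite map_inj_uniq.
- by move=> _ /mapP[x xE ->]; exact: ME.
- by move=> _ _ /mapP[x xE ->] /mapP[y yE ->]; rewrite diff => /sep ->.
Qed.

(** Fubini for the projection of [H / N] to [H / M], whose fibres are
    translates of [M / N]. *)
Lemma section_hbl_trans N M H s C1 C2 :
  is_subgroup N -> is_subgroup M -> is_subgroup H ->
  N `<=` M -> M `<=` H ->
  (forall j, 0 <= s j) -> 0 <= C1 -> 0 <= C2 ->
  section_hbl N M s C1 -> section_hbl M H s C2 ->
  section_hbl N H s (C1 * C2).
Proof.
move=> hN hM hH NM MH s0 C10 C20 h1 h2 E uE EH sep.
apply: (hbl_seq_fibration (pi := rep M) (q := label M)) => //.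
- move=> j x x' xE xE' /label_eqP -/(_ hN) [n Nn en].
  apply/label_eqP => //.
  exists ((rep M x - x) - (rep M x' - x') + n).
    by apply: subgroupD => //; [apply: subgroupB => //; exact: repB|exact: NM].
  by rewrite raddfD en -raddfD opprB addrAC !subrKA.
- move=> _ /mapP[x0 x0E ->].
  apply: (section_hbl_translate (M := M) (x0 := x0)) => //.
  + exact: filter_uniq.
  + move=> x y; rewrite !mem_filter => /andP[_ xE] /andP[_ yE]; exact: sep.
  + by move=> x; rewrite mem_filter => /andP[/eqP /rep_eqP e xE]; exact: e.
- apply: h2; rewrite ?undup_uniq//.
  + move=> z; rewrite mem_undup => /mapP[x xE ->].
    rewrite -[rep M x](subrK x); apply: subgroupD => //; last exact: EH.
    by apply: MH; exact: repB.
  + move=> z z'; rewrite !mem_undup => /mapP[x xE ->] /mapP[y yE ->] e.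
    by rewrite -[LHS]rep_id// -[RHS]rep_id//; apply/rep_eqP.
Qed.

(** If [s j0 = 1] then the factor of index [j0] pulls out of the sum over each
    fibre of [phi j0], on which the remaining inequality is the one for the
    kernel of [phi j0] on [H / N]. *)
Lemma section_hbl_kernel N M H s C (j0 : 'I_m) :
  is_subgroup N -> M = [set x | H x /\ (phi j0 @` N) (phi j0 x)] ->
  is_subgroup H -> (forall j, 0 <= s j) -> s j0 = 1 -> 0 <= C ->
  section_hbl N M s C -> section_hbl N H s C.
Proof.
move=> hN defM hH s0 s1 C0 hNM E uE EH sep; rewrite -[C]mulr1.
pose q (j : 'I_m) (z : Gj j0) := if j == j0 then z else 0.
apply: (hbl_seq_fibration (pi := label N j0) (q := q)) => //.
- by move=> j x x' _ _; rewrite /q; case: eqP => // ->.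
- move=> _ /mapP[x0 x0E ->].
  apply: (section_hbl_translate (M := M) (x0 := x0)) => //.
  + exact: filter_uniq.
  + move=> x y; rewrite !mem_filter => /andP[_ xE] /andP[_ yE]; exact: sep.
  + move=> x; rewrite mem_filter => /andP[/eqP /label_eqP e xE].
    by rewrite defM; split; [apply: subgroupB => //; exact: EH|exact: e].
- case: (undup _) (undup_uniq (map (label N j0) E)) => [|z0 r] ur.
    exact: hbl_seq_small.
  move=> u u0; rewrite mul1r (bigD1 j0)// s1 powRr1; last exact: sumr_ge0.
  have -> : \sum_(y <- undup (map (q j0) (z0 :: r))) u j0 y =
            \sum_(z <- z0 :: r) u j0 z.
    by rewrite /q eqxx map_id undup_id.
  rewrite -[leRHS]/(_ * \prod_(j | j != j0)
    (\sum_(y <- undup (map (q j) (z0 :: r))) u j y) `^ s j).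
  rewrite mulr_suml; apply: ler_sum => z _.
  rewrite [leLHS](bigD1 j0)// s1 powRr1// {1}/q eqxx ler_wpM2l//.
  apply: ler_prod => j jj0; rewrite powR_ge0 andTb.
  have q0 z' : q j z' = 0 by rewrite /q (negbTE jj0).
  have -> : undup (map (q j) (z0 :: r)) = [:: 0].
    elim: (r) => /= [|z' r']; first by rewrite q0.
    by rewrite !q0 !inE !eqxx /=; case: ifP.
  by rewrite big_seq1 q0 lexx.
Qed.

End Sections.

(** * Induction over a lattice of subgroups *)

(** Each [c] stands for the affine inequality [c.1 + t * c.2 <= 0].  Only the
    increasing ones bound [t] from above, and the largest admissible [t] is the
    smallest of their roots. *)
Lemma first_tight (R : realType) (cs : seq (R * R)) :
  (forall c, c \in cs -> c.1 <= 0) -> (exists2 c, c \in cs & 0 < c.2) ->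
  exists t, [/\ 0 <= t, forall c, c \in cs -> c.1 + t * c.2 <= 0 &
    exists c, [/\ c \in cs, 0 < c.2 & c.1 + t * c.2 = 0]].
Proof.
elim: cs => [|c0 cs IH] neg; first by case.
have neg' c : c \in cs -> c.1 <= 0 by move=> h; apply: neg; rewrite inE h orbT.
have c00 : c0.1 <= 0 by apply: neg; rewrite mem_head.
have stop : 0 < c0.2 ->
    (forall c, c \in cs -> c.1 + (- c0.1 / c0.2) * c.2 <= 0) ->
    exists t, [/\ 0 <= t, forall c, c \in c0 :: cs -> c.1 + t * c.2 <= 0 &
    exists c, [/\ c \in c0 :: cs, 0 < c.2 & c.1 + t * c.2 = 0]].
  move=> c0p h; have e : c0.1 + - c0.1 / c0.2 * c0.2 = 0.
    by rewrite divfK ?gt_eqF// subrr.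
  exists (- c0.1 / c0.2); split.
  - by rewrite divr_ge0 ?oppr_ge0// ltW.
  - by move=> c; rewrite inE => /predU1P[->|/h//]; rewrite e.
  - by exists c0; rewrite mem_head.
have [[c1 c1s c1p]|none] := pselect (exists2 c, c \in cs & 0 < c.2); last first.
  case=> c; rewrite inE => /predU1P[->|cs1] cp; last by case: none; exists c.
  apply: stop => // c' c's; have := neg' _ c's.
  have : c'.2 <= 0 by rewrite leNgt; apply/negP => h; apply: none; exists c'.
  have : 0 <= - c0.1 / c0.2 by rewrite divr_ge0 ?oppr_ge0// ltW.
  by nra.
move=> _; have [//|] := IH neg'; first by exists c1.
move=> t [t0 feas [c [cs' cp ctight]]].
have [le0|gt0] := leP (c0.1 + t * c0.2) 0.
  exists t; split=> //.
    by move=> c'; rewrite inE => /predU1P[->//|]; exact: feas.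
  by exists c; rewrite inE cs' orbT.
have c0p : 0 < c0.2 by nra.
apply: stop => // c' c's; have := neg' _ c's; have := feas _ c's.
have tle : - c0.1 / c0.2 <= t by rewrite ler_pdivrMr//; lra.
have : 0 <= - c0.1 / c0.2 by rewrite divr_ge0 ?oppr_ge0// ltW.
move: tle; set t' := _ / _ => tle t'0 h1 h2.
have [c'p|c'n] := leP 0 c'.2; last by nra.
by apply: le_trans h1; rewrite lerD2l ler_wpM2r.
Qed.

Section LatticeInduction.
Variables (R : realType) (m : nat) (G : zmodType) (Gj : 'I_m -> zmodType).
Variable phi : forall j, {additive G -> Gj j}.
Implicit Types (s : 'I_m -> R) (c : R).

(** The subgroups that occur in the induction are the values of [el]; [lam] of
    the natural number [sz M] (resp. [szj j M]) measures [el M] (resp. its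
    image under [phi j]).  The two instances are finite subgroups, with
    [lam = ln] of the cardinality, and rational subspaces, with [lam] of the
    dimension. *)
Variables (L : Type) (el : L -> set G).
Variables (sz : L -> nat) (szj : 'I_m -> L -> nat) (lam : nat -> R) (K : nat).
(** The constants [expR c] that may occur.  Over the rationals only [c = 0] does,
    because a section in which some excess is positive satisfies the inequality
    with no finite constant. *)
Variable okc : R -> Prop.

Hypothesis el_subgroup : forall M, is_subgroup (el M).
Hypothesis el_kernel : forall N H j, el N `<=` el H ->
  exists M, el M = [set x | el H x /\ (phi j @` el N) (phi j x)].
Hypothesis sz_mono : forall N H, el N `<=` el H -> (sz N <= sz H)%N.
Hypothesis sz_strict : forall N H, el N `<=` el H -> ~ (el H `<=` el N) ->
  (sz N < sz H)%N.
Hypothesis szj_eq : forall N H j, el N `<=` el H ->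
  phi j @` el H `<=` phi j @` el N -> szj j N = szj j H.
Hypothesis szj_lt : forall N H j, el N `<=` el H ->
  ~ (phi j @` el H `<=` phi j @` el N) -> lam (szj j N) < lam (szj j H).
Hypothesis sz_bound : forall M, (sz M <= K)%N.
Hypothesis szj_bound : forall M j, (szj j M <= K)%N.
Hypothesis okc0 : okc 0.
Hypothesis m_gt0 : (0 < m)%N.

(** With [lam] the logarithm of the cardinality, this is the logarithm of
    [A(M, s) / A(N, s)]. *)
Definition excess N M s : R := lam (sz M) - lam (sz N) -
  \sum_(j < m) s j * (lam (szj j M) - lam (szj j N)).

Hypothesis base : forall N H s j0 c, okc c -> in_unit_cube s ->
  el N `<=` el H ->
  (forall j, j != j0 -> s j = 0 \/ phi j @` el H `<=` phi j @` el N) ->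
  s j0 < 1 \/ phi j0 @` el H `<=` phi j0 @` el N ->
  excess N H s <= c -> section_hbl phi (el N) (el H) s (expR c).

Let good N H s c := forall M, el N `<=` el M -> el M `<=` el H ->
  excess N M s <= c.

(* with d1, d2 the sizes of phi j1 H and phi j2 H relative to the images of N,
   this direction leaves the excess of H over N unchanged *)
Let moved s (j1 j2 : 'I_m) (d1 d2 t : R) : 'I_m -> R :=
  fun j => s j + t * ((j == j1)%:R / d1 - (j == j2)%:R / d2).

Lemma excess_moved N M s j1 j2 d1 d2 t :
  excess N M (moved s j1 j2 d1 d2 t) = excess N M s +
  t * ((lam (szj j2 M) - lam (szj j2 N)) / d2 -
       (lam (szj j1 M) - lam (szj j1 N)) / d1).
Proof.
rewrite /excess /moved.
have pick (j' : 'I_m) (F : 'I_m -> R) : \sum_(j < m) (j == j')%:R * F j = F j'.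
  rewrite (bigD1 j')//= eqxx mul1r big1 ?addr0// => j /negbTE->.
  by rewrite mul0r.
pose X j := lam (szj j M) - lam (szj j N).
rewrite -/(X j1) -/(X j2) -(pick j1 (fun j => X j / d1)).
rewrite -(pick j2 (fun j => X j / d2)) -sumrB mulr_sumr -[RHS]addrA.
congr (_ + _); rewrite -!sumrN -big_split /=; apply: eq_bigr => j _.
rewrite -/(X j); ring.
Qed.

Lemma excess_trans N M H s :
  excess M H s = excess N H s - excess N M s.
Proof.
rewrite /excess.
have -> : \sum_(j < m) s j * (lam (szj j H) - lam (szj j M)) =
  \sum_(j < m) s j * (lam (szj j H) - lam (szj j N)) -
  \sum_(j < m) s j * (lam (szj j M) - lam (szj j N)).
  by rewrite -sumrB; apply: eq_bigr => j _; ring.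
ring.
Qed.

(** If [el M] attains the maximal excess then the hypothesis passes to
    [M / N] with the same constant and to [H / M] with constant 1, and the two
    inequalities multiply. *)
Lemma section_hbl_tight N M H s c :
  (forall N' H' c', (sz H' - sz N' < sz H - sz N)%N -> okc c' ->
     el N' `<=` el H' -> good N' H' s c' ->
     section_hbl phi (el N') (el H') s (expR c')) ->
  okc c -> in_unit_cube s -> good N H s c ->
  el N `<=` el M -> el M `<=` el H -> ~ (el M `<=` el N) ->
  ~ (el H `<=` el M) -> excess N M s = c ->
  section_hbl phi (el N) (el H) s (expR c).
Proof.
move=> IH okcc s01 gd NM MH nMN nHM eM.
have lNM := sz_strict NM nMN; have lMH := sz_strict MH nHM.
rewrite -[expR c]mulr1 -expR0.
apply: (section_hbl_trans (M := el M)); rewrite ?expR_ge0//.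
- by move=> j; case/andP: (s01 j).
- apply: IH => //; first lia.
  by move=> M' NM' M'M; apply: gd => // x /M'M; exact: MH.
- apply: IH => //; first lia.
  move=> M' MM' M'H; rewrite (excess_trans N) eM subr_le0.
  by apply: gd => // x /NM; exact: MM'.
Qed.

Let fractional s : nat := #|[pred j | 0 < s j < 1]|.

(** The farthest point, in the direction that increases [s j1] and decreases
    [s j2], at which the hypothesis on the excess still holds.  Either [s j1]
    has become 1, or [s j2] has become 0, or the bound [c] is attained by some
    [M].  In the last case [M] differs from [N] and [H], whose excesses are
    constant along the segment. *)
Lemma section_hbl_endpoint N H s c j1 j2 :
  let d j := lam (szj j H) - lam (szj j N) in
  (forall N' H' s' c', (sz H' - sz N' < sz H - sz N)%N -> okc c' ->
     in_unit_cube s' -> el N' `<=` el H' -> good N' H' s' c' ->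
     section_hbl phi (el N') (el H') s' (expR c')) ->
  (forall s', (fractional s' < fractional s)%N -> in_unit_cube s' ->
     good N H s' c -> section_hbl phi (el N) (el H) s' (expR c)) ->
  okc c -> in_unit_cube s -> el N `<=` el H -> good N H s c ->
  j1 != j2 -> 0 < s j1 < 1 -> 0 < s j2 < 1 -> 0 < d j1 -> 0 < d j2 ->
  exists t, [/\ 0 <= t, in_unit_cube (moved s j1 j2 (d j1) (d j2) t) &
    section_hbl phi (el N) (el H) (moved s j1 j2 (d j1) (d j2) t) (expR c)].
Proof.
move=> d IHsz IHfrac okcc s01 NH gd j12 sj1 sj2 d1 d2.
(* only finitely many values of (sz M, szj M) occur *)
pose T : finType := ('I_K.+1 * {ffun 'I_m -> 'I_K.+1})%type.
pose occurs (k : T) := `[< exists M, [/\ el N `<=` el M, el M `<=` el H,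
  sz M = k.1 & forall j, szj j M = k.2 j] >].
pose cst (k : T) : R * R :=
  (lam k.1 - lam (sz N) -
     \sum_(j < m) s j * (lam (k.2 j) - lam (szj j N)) - c,
   (lam (k.2 j2) - lam (szj j2 N)) / d j2 -
   (lam (k.2 j1) - lam (szj j1 N)) / d j1).
pose cs := [:: (s j1 - 1, (d j1)^-1), (- s j2, (d j2)^-1) &
  [seq cst k | k <- enum T & occurs k]].
have cstE M (k : T) : sz M = k.1 -> (forall j, szj j M = k.2 j) ->
    forall t, excess N M (moved s j1 j2 (d j1) (d j2) t) - c =
    (cst k).1 + t * (cst k).2.
  move=> e1 e2 t; rewrite excess_moved /excess /cst /= -e1 -!e2.
  rewrite [X in _ = _ - X - _ + _](eq_bigr (fun j =>
    s j * (lam (szj j M) - lam (szj j N)))) => [|j _]; last by rewrite -e2.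
  by rewrite -/(d j1) -/(d j2); ring.
have mov0 : moved s j1 j2 (d j1) (d j2) 0 = s.
  by apply/funext => j; rewrite /moved mul0r addr0.
have [||t [t0 feas [c0 [c0s c0p tight]]]] := @first_tight R cs.
- move=> x; rewrite !inE => /or3P[/eqP->|/eqP->|/mapP[k]] /=.
  + by lra.
  + by lra.
  + rewrite mem_filter => /andP[/asboolP[M [NM MH e1 e2]] _] ->.
    have := cstE M k e1 e2 0; rewrite mov0 mul0r addr0 => <-.
    by rewrite subr_le0; exact: gd.
- by exists (s j1 - 1, (d j1)^-1); rewrite ?mem_head//= invr_gt0.
exists t; set s' := moved _ _ _ _ _ _.
have s'1 : s' j1 = s j1 + t / d j1.
  by rewrite /s' /moved eqxx (negbTE j12) mul0r subr0 mul1r.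
have s'2 : s' j2 = s j2 - t / d j2.
  by rewrite /s' /moved eqxx eq_sym (negbTE j12) mul0r sub0r mul1r mulrN.
have s'o j : j != j1 -> j != j2 -> s' j = s j.
  by rewrite /s' /moved => /negbTE-> /negbTE->; rewrite !mul0r subrr mulr0 addr0.
have td1 : 0 <= t / d j1 by rewrite divr_ge0// ltW.
have td2 : 0 <= t / d j2 by rewrite divr_ge0// ltW.
have b1 : s' j1 <= 1.
  have := feas (s j1 - 1, (d j1)^-1); rewrite mem_head /= s'1 => /(_ isT).
  by lra.
have b2 : 0 <= s' j2.
  have := feas (- s j2, (d j2)^-1); rewrite !inE eqxx orbT /= s'2.
  by move=> /(_ isT); lra.
have s'01 : in_unit_cube s'.
  move=> j; have [->|n1] := eqVneq j j1; first by rewrite b1 s'1; lra.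
  have [->|n2] := eqVneq j j2; first by rewrite b2 s'2; lra.
  by rewrite s'o.
have gd' : good N H s' c.
  move=> M NM MH.
  pose k : T := (inord (sz M), [ffun j => inord (szj j M)]).
  have e1 : sz M = k.1 by rewrite /= inordK// ltnS.
  have e2 j : szj j M = k.2 j by rewrite /= ffunE inordK// ltnS.
  rewrite -subr_le0 (cstE M k e1 e2 t); apply: feas; rewrite !inE.
  apply/orP; right; apply/orP; right; apply: map_f; rewrite mem_filter.
  by rewrite mem_enum andbT; apply/asboolP; exists M.
have fewer : s' j1 = 1 \/ s' j2 = 0 -> (fractional s' < fractional s)%N.
  move=> h; apply: proper_card; apply/properP; split.
    apply/fintype.subsetP => j; rewrite !inE.
    have [->|n1] := eqVneq j j1; first by rewrite sj1.
    have [->|n2] := eqVneq j j2; first by rewrite sj2.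
    by rewrite s'o.
  by case: h => h; [exists j1|exists j2]; rewrite !inE ?sj1 ?sj2// h ltxx ?andbF.
split=> //; move: c0s; rewrite !inE => /or3P[/eqP c0E|/eqP c0E|].
- apply: IHfrac => //; apply: fewer; left; rewrite s'1.
  by move: tight; rewrite c0E /=; lra.
- apply: IHfrac => //; apply: fewer; right; rewrite s'2.
  by move: tight; rewrite c0E /=; lra.
- case/mapP => k; rewrite mem_filter => /andP[/asboolP[M [NM MH e1 e2]] _] c0E.
  move: tight c0p; rewrite c0E => tight c0p.
  apply: (section_hbl_tight (M := M)) => //.
  + by move=> N' H' c' *; apply: IHsz.
  + move=> MN; move: c0p; rewrite /= -!e2.
    rewrite -!(szj_eq NM); try by move=> y [x Mx <-]; exists x => //; exact: MN.
    by rewrite !subrr !mul0r subrr ltxx.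
  + move=> HM; move: c0p; rewrite /= -!e2.
    rewrite !(szj_eq MH); try by move=> y [x Hx <-]; exists x => //; exact: HM.
    by rewrite -/(d j1) -/(d j2) !divff ?gt_eqF// subrr ltxx.
  + by apply/eqP; rewrite -subr_eq0 (cstE M k e1 e2) tight.
Qed.

(** Induction on the length of the section [H / N] and the number of
    non-integral exponents.  An exponent equal to 1 reduces [H] to a kernel.
    If two exponents with nontrivial images are fractional then [s] lies on a segment of admissible
    exponents at whose ends either the number of fractional exponents drops or
    an intermediate subgroup attains the maximal excess, and the inequality is
    log-convex along the segment. *)
Theorem lattice_section_hbl N H s c : okc c -> in_unit_cube s ->
  el N `<=` el H -> good N H s c ->
  section_hbl phi (el N) (el H) s (expR c).
Proof.
have [n] := ubnP (sz H - sz N); elim: n => // n IHn in N H s c *.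
rewrite ltnS => szn.
have [k] := ubnP (fractional s); elim: k => // k IHk in s *.
rewrite ltnS => sk okcc s01 NH gd.
have s0 j : 0 <= s j by case/andP: (s01 j).
have IHsz N' H' s' c' : (sz H' - sz N' < sz H - sz N)%N -> okc c' ->
    in_unit_cube s' -> el N' `<=` el H' -> good N' H' s' c' ->
    section_hbl phi (el N') (el H') s' (expR c').
  by move=> lt; apply: IHn; exact: leq_trans lt szn.
pose act j := ~ (phi j @` el H `<=` phi j @` el N).
have [[j [sj actj]]|no1] := pselect (exists j, s j = 1 /\ act j).
  have [M ME] := el_kernel j NH.
  have MH : el M `<=` el H by rewrite ME => x [].
  have NM : el N `<=` el M by rewrite ME => x Nx; split; [exact: NH|exists x].
  apply: (section_hbl_kernel (M := el M) (j0 := j)) => //.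
  apply: IHsz => //; last by move=> M' h1 h2; apply: gd => // x /h2; exact: MH.
  have := sz_mono NM; have : (sz M < sz H)%N; last lia.
  apply: sz_strict => // HM; apply: actj => _ [x Hx <-].
  by move: (HM _ Hx); rewrite ME => -[].
have lt1 j : act j -> s j < 1.
  move=> aj; rewrite lt_def; have /andP[_ ->] := s01 j; rewrite andbT.
  by apply/eqP => e; apply: no1; exists j.
have [[j1 [j2 [j12 s1 s2 a1 a2]]]|noact] := pselect (exists j1 j2,
    [/\ j1 != j2, 0 < s j1, 0 < s j2, act j1 & act j2]).
  have d1 : 0 < lam (szj j1 H) - lam (szj j1 N) by rewrite subr_gt0 szj_lt.
  have d2 : 0 < lam (szj j2 H) - lam (szj j2 N) by rewrite subr_gt0 szj_lt.
  have s1' : 0 < s j1 < 1 by rewrite s1 lt1.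
  have s2' : 0 < s j2 < 1 by rewrite s2 lt1.
  have IHfrac s' : (fractional s' < fractional s)%N -> in_unit_cube s' ->
      good N H s' c -> section_hbl phi (el N) (el H) s' (expR c).
    by move=> lt *; apply: IHk => //; exact: leq_trans lt sk.
  have [t [t0 c0 h]] :=
    section_hbl_endpoint IHsz IHfrac okcc s01 NH gd j12 s1' s2' d1 d2.
  have j21 : j2 != j1 by rewrite eq_sym.
  have [t' [t'0 c'0 h']] :=
    section_hbl_endpoint IHsz IHfrac okcc s01 NH gd j21 s2' s1' d2 d1.
  have [tt0|ttn] := eqVneq (t + t') 0.
    have tz : t = 0 by lra.
    move: h; rewrite tz; congr (section_hbl _ _ _ _ _).
    by apply/funext => j; rewrite /moved mul0r addr0.
  have ttp : 0 < t + t' by rewrite lt_def ttn addr_ge0.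
  move=> E uE EH sep.
  have -> : expR c = expR c `^ (1 - t / (t + t')) * expR c `^ (t / (t + t')).
    rewrite -powRD ?subrK ?powRr1 ?expR_ge0//.
    by apply/implyP => _; rewrite gt_eqF// expR_gt0.
  apply: (hbl_seq_interpolation _ _ _ _ _ _ (h E uE EH sep) (h' E uE EH sep));
    rewrite ?expR_ge0//.
  + by move=> j; case/andP: (c0 j).
  + by move=> j; case/andP: (c'0 j).
  + by rewrite divr_ge0 ?(ltW ttp)//= ler_pdivrMr// mul1r; lra.
  + move=> j; rewrite /moved.
    set e := (j == j1)%:R / _; set e' := (j == j2)%:R / _.
    by field.
have := @base N H s; have [[j0 [sj0 aj0]]|none] :=
    pselect (exists j0, 0 < s j0 /\ act j0).
  move=> /(_ j0); apply=> //; last exact: gd.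
    move=> j jj0; have [->|sjn] := eqVneq (s j) 0; first by left.
    right; apply: contrapT => aj; apply: noact; exists j, j0; split=> //.
    by rewrite lt_def sjn s0.
  by left; exact: lt1.
have inact j : s j = 0 \/ phi j @` el H `<=` phi j @` el N.
  have [->|sjn] := eqVneq (s j) 0; first by left.
  right; apply: contrapT => aj; apply: none; exists j; split=> //.
  by rewrite lt_def sjn s0.
move=> /(_ (Ordinal m_gt0)); apply=> //; last exact: gd.
by case: (inact (Ordinal m_gt0)) => [->|h]; [left; exact: ltr01|right].
Qed.

End LatticeInduction.

(** * Cardinalities of finite sets and subgroups *)

Section SetCard.

Lemma set_card_seq (T : choiceType) (A : set T) : finite_set A ->
  exists s : seq T, [/\ uniq s, forall x, x \in s <-> A x & set_card A = size s].
Proof.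
move=> fA; exists (finmap.enum_fset (fset_set A)); split=> [||//].
  by apply: finmap.fset_uniq.
move=> x; have e := in_fset_set fA x; split=> [xs|Ax].
  by have h := etrans (esym e) xs; exact: set_mem h.
by apply: (etrans e); exact: mem_set.
Qed.

Lemma set_card_eq_size (T : choiceType) (A : set T) (s : seq T) :
  uniq s -> (forall x, x \in s <-> A x) -> set_card A = size s.
Proof.
move=> us sA; have fA : finite_set A.
  by rewrite (_ : A = [set` s]) ?finite_seq//; apply/seteqP; split=> x /=; rewrite sA.
have [s' [us' s'A ->]] := set_card_seq fA.
apply: perm_size; apply: uniq_perm => // x.
by apply/idP/idP => [/s'A/sA|/sA/s'A].
Qed.

Lemma set_card_ge (T : choiceType) (A : set T) (s : seq T) : finite_set A ->
  uniq s -> (forall x, x \in s -> A x) -> (size s <= set_card A)%N.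
Proof.
move=> fA us sA; have [s' [us' s'A ->]] := set_card_seq fA.
by apply: uniq_leq_size => // x /sA /s'A.
Qed.

Lemma set_card_le_inj (T U : choiceType) (A : set T) (B : set U) (f : T -> U) :
  finite_set A -> finite_set B -> (forall x, A x -> B (f x)) ->
  (forall x y, A x -> A y -> f x = f y -> x = y) ->
  (set_card A <= set_card B)%N.
Proof.
move=> fA fB AB inj; have [s [us sA ->]] := set_card_seq fA.
rewrite -(size_map f); apply: set_card_ge => //.
  by rewrite map_inj_in_uniq// => x y /sA Ax /sA; exact: inj.
by move=> _ /mapP[x /sA Ax ->]; exact: AB.
Qed.

Lemma set_card_le (T : choiceType) (A B : set T) : finite_set B -> A `<=` B ->
  (set_card A <= set_card B)%N.
Proof.
move=> fB AB; apply: (set_card_le_inj (f := id)) => //.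
exact: sub_finite_set AB fB.
Qed.

Lemma set_card_lt (T : choiceType) (A B : set T) : finite_set B -> A `<=` B ->
  ~ (B `<=` A) -> (set_card A < set_card B)%N.
Proof.
move=> fB AB /existsNP[b /not_implyP[Bb nAb]].
have [s [us sA ->]] := set_card_seq (sub_finite_set AB fB).
rewrite -[(size s).+1]/(size (b :: s)); apply: set_card_ge => //=.
  by rewrite us andbT; apply/negP => /sA.
by move=> x; rewrite inE => /predU1P[->//|/sA]; exact: AB.
Qed.

Lemma set_card_image_le (T U : choiceType) (f : T -> U) (A : set T) :
  finite_set A -> (set_card (f @` A) <= set_card A)%N.
Proof.
move=> fA; have [s [us sA ->]] := set_card_seq fA.
rewrite (_ : set_card _ = size (undup (map f s))).
  by rewrite (leq_trans (size_undup _))// size_map.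
apply: set_card_eq_size; first exact: undup_uniq.
move=> y; rewrite mem_undup; split=> [/mapP[x /sA Ax ->]|[x /sA Ax <-]].
  by exists x.
exact: map_f.
Qed.

Lemma set_card_range_le (I : finType) (T : choiceType) (g : I -> T)
    (A : set T) :
  A `<=` range g -> (set_card A <= #|I|)%N.
Proof.
move=> Ag; have fg : finite_set (range g) by exact/finite_image/finite_finset.
apply: leq_trans (set_card_le fg Ag) _.
apply: leq_trans (set_card_image_le _ (finite_finset)) _.
rewrite (_ : set_card [set: I] = size (enum I)) ?cardE//.
by apply: set_card_eq_size; [exact: enum_uniq|move=> i; rewrite mem_enum].
Qed.

Lemma set_card1 (T : choiceType) (x : T) : set_card [set x] = 1%N.
Proof.
by apply: (@set_card_eq_size _ _ [:: x]) => // y; rewrite inE; split=> /eqP.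
Qed.

Variables (V W : zmodType).
Implicit Types (N M H : set V).

Lemma set_card_subgroup_gt0 H : finite_set H -> is_subgroup H ->
  (0 < set_card H)%N.
Proof.
move=> fH hH; apply: (@set_card_ge _ H [:: 0]) => // x; rewrite inE => /eqP->.
exact: subgroup0.
Qed.

(** Distinct cosets are disjoint. *)
Lemma separated_size_le N M (F : seq V) : finite_set M ->
  is_subgroup N -> is_subgroup M -> N `<=` M -> uniq F ->
  (forall x, x \in F -> M x) -> {in F &, forall x y, N (x - y) -> x = y} ->
  (size F * set_card N <= set_card M)%N.
Proof.
move=> fM hN hM NM uF FM sep.
have [s [us sN ->]] := set_card_seq (sub_finite_set NM fM).
rewrite -(size_allpairs (fun x n => x + n)); apply: set_card_ge => //.
  apply: allpairs_uniq => // -[x n] [x' n'] /allpairsP[[a b] /= [aF bs [-> ->]]].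
  move=> /allpairsP[[a' b'] /= [aF' bs' [-> ->]]] e.
  have aa' : a = a'.
    apply: sep => //; have -> : a - a' = b' - b.
      by apply/eqP; rewrite subr_eq addrAC [b' + _]addrC -[a' + _]e addrK.
    by apply: subgroupB => //; apply/sN.
  by move: e; rewrite aa' => /addrI ->.
move=> _ /allpairsP[[a b] /= [aF bs ->]]; apply: subgroupD => //.
  exact: FM.
by apply: NM; apply/sN.
Qed.

(** Let [M] be the part of [H] that [f] maps into [f N], and [K] the kernel of
    [f] on [H].  Then [|H| = |K| |f H|] and [|M| = |K| |f N|], so both sides
    are equal to [|K| |f H| |f N|]. *)
Lemma set_card_preimage_le (f : {additive V -> W}) N H : finite_set H ->
  is_subgroup N -> is_subgroup H -> N `<=` H ->
  (set_card [set x | H x /\ (f @` N) (f x)] * set_card (f @` H) <=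
   set_card H * set_card (f @` N))%N.
Proof.
move=> fH hN hH NH; set M := [set x | _].
pose K := [set x | H x /\ f x = 0].
have KH : K `<=` H by move=> x [].
have hK : is_subgroup K.
  apply/subgroupP; split; first by split; [exact: subgroup0|rewrite raddf0].
  move=> x y [Hx fx] [Hy fy]; split; first exact: subgroupB.
  by rewrite raddfB fx fy subrr.
have fM : finite_set M by apply: sub_finite_set fH => x [].
have fN : finite_set N by exact: sub_finite_set NH fH.
have lift (A : set V) : exists g : W -> V,
    forall y, (f @` A) y -> A (g y) /\ f (g y) = y.
  have /choice[g gP] : forall y, exists x, (f @` A) y -> A x /\ f x = y.
    move=> y; have [[x Ax <-]|n] := pselect ((f @` A) y); last by exists 0.
    by exists x.
  by exists g.
have leH : (set_card (f @` H) * set_card K <= set_card H)%N.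
  have [g gP] := lift H.
  have [s [us sH ->]] := set_card_seq (finite_image f fH).
  rewrite -(size_map g); apply: separated_size_le => //.
  - rewrite map_inj_in_uniq// => x y /sH /gP[_ ex] /sH /gP[_ ey] e.
    by rewrite -ex -ey e.
  - by move=> _ /mapP[y /sH /gP[Hg _] ->].
  - move=> _ _ /mapP[y /sH /gP[_ ey] ->] /mapP[y' /sH /gP[_ ey'] ->] [_].
    by rewrite raddfB ey ey' => /eqP; rewrite subr_eq0 => /eqP ->.
have leM : (set_card M <= set_card (f @` N) * set_card K)%N.
  have [g gP] := lift N.
  have [sM [usM sME ->]] := set_card_seq fM.
  have [sN [usN sNE ->]] := set_card_seq (finite_image f fN).
  have [sK [usK sKE ->]] := set_card_seq (sub_finite_set KH fH).
  rewrite -(size_allpairs pair) -(size_map (fun x => (f x, x - g (f x))) sM).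
  apply: uniq_leq_size.
    by rewrite map_inj_uniq// => x y [e]; rewrite e => /addIr.
  move=> _ /mapP[x /sME[Hx fx] ->]; have [Ng eg] := gP _ fx.
  apply/allpairsP; exists (f x, x - g (f x)); split=> //=; first by apply/sNE.
  apply/sKE; split; last by rewrite raddfB eg subrr.
  by apply: subgroupB => //; exact: NH.
by rewrite (leq_trans (leq_mul leM (leqnn _)))// -mulnA mulnC leq_mul2r mulnC leH orbT.
Qed.

End SetCard.

(** * Finite groups *)

(** Each summand is at most the product of the norms. *)
Lemma hbl_seq_size (R : realType) (m : nat) (X : eqType) (Y : 'I_m -> eqType)
    (s : 'I_m -> R) (E : seq X) (p : forall j, X -> Y j) :
  (forall j, 0 <= s j) -> hbl_seq s E p (size E)%:R.
Proof.
move=> s0 u u0.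
have -> : (size E)%:R = \sum_(x <- E) (1 : R).
  by rewrite big_const_seq count_predT iter_addr addr0.
rewrite mulr_suml [leLHS]big_seq [leRHS]big_seq; apply: ler_sum => x xE.
rewrite mul1r; apply: prod_powR_le => // j; rewrite u0/=.
rewrite (bigD1_seq (p j x)) ?undup_uniq ?mem_undup ?map_f//=.
by rewrite lerDl sumr_ge0.
Qed.

Section FiniteGroups.
Variables (R : realType) (m : nat) (G : zmodType) (Gj : 'I_m -> zmodType).
Variable phi : forall j, {additive G -> Gj j}.
Implicit Types (s : 'I_m -> R) (N M H : set G).

Lemma section_hbl_index N H s : finite_set H -> is_subgroup N ->
  is_subgroup H -> N `<=` H -> (forall j, 0 <= s j) ->
  section_hbl phi N H s ((set_card H)%:R / (set_card N)%:R).
Proof.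
move=> fH hN hH NH s0 E uE EH sep.
apply: hbl_seq_le (hbl_seq_size _ _ s0).
have fN : finite_set N by exact: sub_finite_set NH fH.
rewrite ler_pdivlMr ?ltr0n ?set_card_subgroup_gt0//.
by rewrite -natrM ler_nat; exact: separated_size_le.
Qed.

(** With a single nontrivial exponent the inequality interpolates between the
    exponents 0 and 1; for the latter [H] is replaced by a kernel. *)
Lemma section_hbl_one_exponent N H s j0 : finite_set H -> is_subgroup N ->
  is_subgroup H -> N `<=` H -> in_unit_cube s ->
  section_hbl phi N H s (expR (ln (set_card H)%:R - ln (set_card N)%:R -
    s j0 * (ln (set_card (phi j0 @` H))%:R - ln (set_card (phi j0 @` N))%:R))).
Proof.
move=> fH hN hH NH s01 E uE EH sep.
pose M := [set x | H x /\ (phi j0 @` N) (phi j0 x)].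
have MH : M `<=` H by move=> x [].
have NM : N `<=` M by move=> x Nx; split; [exact: NH|exists x].
have hM : is_subgroup M.
  apply/subgroupP; split; first by apply: NM; exact: subgroup0.
  move=> x y [Hx px] [Hy py]; split; first exact: subgroupB.
  by rewrite raddfB; apply: subgroupB => //; exact: subgroup_image.
have fM := sub_finite_set MH fH; have fN := sub_finite_set NM fM.
have s0 j : 0 <= s j by case/andP: (s01 j).
pose at0 (e : R) j := if j == j0 then e else s j.
have at0_ge0 e j : 0 <= e -> 0 <= at0 e j by rewrite /at0; case: eqP.
have pos A : finite_set A -> is_subgroup A -> 0 < (set_card A)%:R :> R.
  by move=> *; rewrite ltr0n set_card_subgroup_gt0.
have h0 := section_hbl_index fH hN hH NH (fun j => at0_ge0 0 j (lexx 0)).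
have h1 : section_hbl phi N H (at0 1) ((set_card M)%:R / (set_card N)%:R).
  apply: (section_hbl_kernel (M := M) (j0 := j0)) => //.
  - by move=> j; exact: at0_ge0.
  - by rewrite /at0 eqxx.
  - by apply: section_hbl_index => // j; exact: at0_ge0.
apply: hbl_seq_le (hbl_seq_interpolation (t := s j0) _ _ _ _ _ _
  (h0 E uE EH sep) (h1 E uE EH sep)); last 6 first.
- by move=> j; exact: at0_ge0.
- by move=> j; exact: at0_ge0.
- exact: s01.
- by move=> j; rewrite /at0; case: eqP => [->|_]; ring.
- by rewrite divr_ge0.
- by rewrite divr_ge0.
have dpos A : finite_set A -> is_subgroup A ->
    0 < (set_card A)%:R / (set_card N)%:R :> R.
  by move=> fA hA; rewrite divr_gt0// pos.
rewrite /powR !gt_eqF ?dpos// -expRD ler_expR !ln_div ?posrE ?pos//.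
have fpH := finite_image (phi j0) fH; have fpN := finite_image (phi j0) fN.
have hpH := subgroup_image (phi j0) hH; have hpN := subgroup_image (phi j0) hN.
have : ln (set_card M * set_card (phi j0 @` H))%:R <=
       ln (set_card H * set_card (phi j0 @` N))%:R :> R.
  rewrite ler_ln ?posrE ?ltr0n ?muln_gt0 ?set_card_subgroup_gt0//.
  by rewrite ler_nat; exact: set_card_preimage_le.
rewrite !natrM !lnM ?posrE ?pos// => le.
have := s0 j0; nra.
Qed.

(** The induction for the lattice of subgroups of [H], measured by the
    logarithm of the cardinality: the excess over the trivial group is the
    logarithm of the ratio in the hypothesis. *)
Theorem finite_subgroup_hbl (H : set G) s (A : R) : (0 < m)%N ->
  finite_set H -> is_subgroup H -> in_unit_cube s ->
  (forall M, is_subgroup M -> M `<=` H -> (set_card M)%:R *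
     \prod_(j < m) (set_card (phi j @` M))%:R `^ (- s j) <= A) ->
  section_hbl phi [set 0] H s A.
Proof.
move=> m0 fH hH s01 ratio.
pose L := {M : set G | is_subgroup M /\ M `<=` H}.
pose el (M : L) := sval M.
pose sz (M : L) := set_card (el M).
pose szj j (M : L) := set_card (phi j @` el M).
pose lam (n : nat) : R := ln n%:R.
have elS (M : L) : is_subgroup (el M) by case: M => M [].
have elH (M : L) : el M `<=` H by case: M => M [].
have fin (M : L) : finite_set (el M) by exact: sub_finite_set (elH M) fH.
have fim (M : L) j : finite_set (phi j @` el M) by exact: finite_image.
have szj_gt0 (M : L) j : 0 < (szj j M)%:R :> R.
  rewrite ltr0n; apply: set_card_subgroup_gt0; first exact: fim.
  by apply: subgroup_image; exact: elS.
have sub0 : is_subgroup [set 0 : G].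
  by apply/subgroupP; split=> // x y /= -> ->; rewrite subrr.
have sub0H : [set 0] `<=` H by move=> _ ->; exact: subgroup0.
pose N : L := exist _ [set 0] (conj sub0 sub0H).
pose T : L := exist _ H (conj hH (@subset_refl _ H)).
have imN (M : L) : (forall j, phi j @` el N `<=` phi j @` el M).
  by move=> j _ [_ -> <-]; exists 0 => //; exact: subgroup0.
have sz0 j : szj j N = 1%N.
  by rewrite /szj /= image_set1 raddf0 set_card1.
have lam1 : lam 1%N = 0 by rewrite /lam ln1.
have expE (M : L) : expR (excess sz szj lam N M s) =
    (set_card (el M))%:R * \prod_(j < m) (szj j M)%:R `^ (- s j).
  rewrite /excess /sz /= set_card1 lam1 subr0 expRD lnK; last first.
    by rewrite posrE ltr0n set_card_subgroup_gt0.
  congr (_ * _); rewrite -sumrN expR_sum; apply: eq_bigr => j _.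
  by rewrite /powR gt_eqF// sz0 lam1 subr0 mulNr.
have A0 : 0 < A.
  apply: lt_le_trans (ratio [set 0] sub0 sub0H).
  by rewrite -(expE N) expR_gt0.
rewrite -[A]lnK ?posrE//.
apply: (@lattice_section_hbl R m G Gj phi L el sz szj lam (set_card H)
  (fun=> True) elS _ _ _ _ _ _ _ I m0 _ N T) => //.
- move=> N' H' j NH'.
  have sM : is_subgroup [set x | el H' x /\ (phi j @` el N') (phi j x)].
    apply/subgroupP; split.
      by split; [exact: subgroup0|rewrite raddf0; apply: subgroup0; exact: subgroup_image].
    move=> x y [Hx px] [Hy py]; split; first exact: subgroupB.
    by rewrite raddfB; apply: subgroupB => //; exact: subgroup_image.
  have MH : [set x | el H' x /\ (phi j @` el N') (phi j x)] `<=` H.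
    by move=> x [/elH].
  by exists (exist (fun M => is_subgroup M /\ M `<=` H) _ (conj sM MH)).
- by move=> N' H' NH'; exact: set_card_le.
- by move=> N' H' NH'; exact: set_card_lt.
- move=> N' H' j NH' HN; congr set_card; apply/seteqP; split=> //.
  by move=> _ [x Nx <-]; exists x => //; exact: NH'.
- move=> N' H' j NH' nHN; rewrite ltr_ln ?posrE// ltr_nat.
  apply: set_card_lt => //; first exact: fim.
  by move=> _ [x Nx <-]; exists x => //; exact: NH'.
- by move=> M; exact: set_card_le.
- move=> M j; apply: leq_trans (set_card_image_le _ _) _ => //.
  exact: set_card_le.
- move=> N' H' s' j0 c _ s'01 NH' inact _ le E uE EH sep.
  apply: hbl_seq_le
    (section_hbl_one_exponent j0 (fin H') (elS N') (elS H') NH' s'01 uE EH sep).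
  rewrite ler_expR (le_trans _ le)// /excess (bigD1 j0)//= big1 ?addr0// => j jj0.
  have [->|HN] := inact _ jj0; first by rewrite mul0r.
  rewrite (_ : szj j H' = szj j N') ?subrr ?mulr0//; congr set_card.
  by apply/seteqP; split=> // _ [x Nx <-]; exists x => //; exact: NH'.
- move=> M _ MH; rewrite -ler_expR lnK ?posrE// expE; exact: ratio.
Qed.

End FiniteGroups.

(** * Rational vector spaces *)

Section RationalSpaces.
Variables (R : realType) (m r : nat) (F : 'I_m -> 'M[rat]_r).

(** The induction for the lattice of subspaces, measured by the dimension: the
    hypothesis says that all subspaces have nonpositive excess.  A section with
    a single nontrivial exponent [s j0 < 1] and nonpositive excess is trivial, because
    [F j0] does not increase the dimension of the quotient. *)
Theorem rational_hbl (s : 'I_m -> R) (E : seq 'rV[rat]_r) : (0 < m)%N ->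
  in_unit_cube s ->
  (forall W : 'M[rat]_r,
     (\rank W)%:R <= \sum_(j < m) s j * (\rank (W *m F j))%:R) ->
  uniq E -> hbl_seq s E (fun j v => v *m F j) 1.
Proof.
move=> m0 s01 dims uE.
pose phi j : {additive 'rV[rat]_r -> 'rV[rat]_r} := mulmxr (F j).
pose el (A : 'M[rat]_r) := [set x : 'rV[rat]_r | (x <= A)%MS].
pose szj j (A : 'M[rat]_r) := \rank (A *m F j).
pose lam (n : nat) : R := n%:R.
have elP A B : el A `<=` el B <-> (A <= B)%MS.
  by split=> [AB|AB x /= xA]; [apply/rV_subP|exact: submx_trans AB].
have imP A j y : (phi j @` el A) y <-> (y <= A *m F j)%MS.
  split=> [[x /= xA <-]|/submxP[D ->]]; first exact: submxMr.
  by exists (D *m A); [exact: submxMl|rewrite /= mulmxA].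
have im_subP A B j : phi j @` el A `<=` phi j @` el B <->
    (A *m F j <= B *m F j)%MS.
  split=> [AB|AB y /imP yA]; last exact/imP/(submx_trans yA).
  by apply/rV_subP => y /imP /AB /imP.
have szj_mono A B j : el A `<=` el B -> (szj j A <= szj j B)%N.
  by move=> /elP AB; apply: mxrankS; exact: submxMr.
have subg A : is_subgroup (el A).
  apply/subgroupP; split; first exact: sub0mx.
  by move=> x y /= xA yA; apply: addmx_sub; rewrite ?eqmx_opp.
suff base : section_hbl phi (el 0) (el 1%:M) s (expR 0).
  rewrite -expR0.
  apply: (@hbl_seq_of_label R m _ _ phi (el 0)); rewrite ?expR_ge0//.
    by move=> j; case/andP: (s01 j).
  apply: base => // [x _|x y _ _]; first exact: submx1.
  by rewrite /el /= submx0 subr_eq0 => /eqP.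
apply: (@lattice_section_hbl R m _ _ phi _ el (@mxrank rat r r) szj lam r
  (fun c => c = 0) subg) => //.
- move=> N H j NH; exists (H :&: (N + kermx (F j)))%MS.
  apply/seteqP; split=> x; rewrite {1}/el /=.
    rewrite sub_capmx => /andP[xH /sub_addsmxP[[a b] /= xE]]; split=> //.
    apply/imP; rewrite xE mulmxDl -[b *m _ *m _]mulmxA mulmx_ker mulmx0 addr0.
    by rewrite -mulmxA submxMl.
  move=> [xH /imP /submxP[D xE]]; rewrite /el /= sub_capmx (xH : (x <= H)%MS) /=.
  rewrite -[x](subrK (D *m N)) addrC; apply: addmx_sub_adds.
    exact: submxMl.
  by rewrite sub_kermx mulmxBl xE mulmxA subrr.
- by move=> N H /elP; exact: mxrankS.
- move=> N H /elP NH /elP nHN; rewrite ltn_neqAle mxrankS// andbT.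
  by rewrite (mxrank_leqif_sup NH)//; apply/negP.
- move=> N H j NH /im_subP HN; apply/eqP; rewrite eqn_leq szj_mono//=.
  exact: mxrankS.
- move=> N H j NH nHN; rewrite ltr_nat ltn_neqAle szj_mono// andbT.
  rewrite (mxrank_leqif_sup (submxMr _ _)); last exact/elP.
  by apply/negP => /im_subP.
- by move=> M; exact: rank_leq_row.
- by move=> M j; exact: rank_leq_row.
- move=> N H s' j0 c -> s'01 NH inact lt1 le E' uE' EH sep; rewrite expR0.
  suff HN : el H `<=` el N.
    apply: hbl_seq_small; case: E' uE' EH sep => [|x [|y E']]//= uE' EH sep.
    exfalso; move: uE'; rewrite inE => /andP[/norP[/eqP xy _] _]; apply: xy.
    apply: sep; rewrite ?inE ?eqxx ?orbT//; apply: subgroupB => //.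
      by apply/HN/EH; rewrite mem_head.
    by apply/HN/EH; rewrite !inE eqxx orbT.
  apply/elP; move/elP: (NH) => NH'; rewrite -(mxrank_leqif_sup NH').
  rewrite eqn_leq mxrankS//= -(ler_nat R).
  have drop : (\rank H)%:R - (\rank N)%:R <=
      s' j0 * ((szj j0 H)%:R - (szj j0 N)%:R) :> R.
    rewrite -subr_le0; apply: le_trans le; rewrite /excess.
    rewrite [leRHS](_ : _ = (\rank H)%:R - (\rank N)%:R -
      s' j0 * ((szj j0 H)%:R - (szj j0 N)%:R))//; congr (_ - _).
    rewrite (bigD1 j0)//= big1 ?addr0// => j jj0.
    have [->|HN] := inact _ jj0; first by rewrite mul0r.
    rewrite (_ : szj j H = szj j N) ?subrr ?mulr0//; apply/eqP.
    by rewrite eqn_leq (szj_mono _ _ _ NH) andbT; apply: mxrankS; exact/im_subP.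
  have ker : (szj j0 H)%:R - (szj j0 N)%:R <= (\rank H)%:R - (\rank N)%:R :> R.
    have : (\rank (N :&: kermx (F j0)) <= \rank (H :&: kermx (F j0)))%N.
      by apply: mxrankS; exact: capmxS.
    rewrite -(ler_nat R) -(mxrank_mul_ker H (F j0)) -(mxrank_mul_ker N (F j0)).
    by rewrite !natrD /szj; lra.
  have szpos : 0 <= (szj j0 H)%:R - (szj j0 N)%:R :> R.
    by rewrite subr_ge0 ler_nat szj_mono.
  have rkpos : 0 <= (\rank H)%:R - (\rank N)%:R :> R.
    by rewrite subr_ge0 ler_nat mxrankS.
  have s'0 : 0 <= s' j0 by case/andP: (s'01 j0).
  rewrite -subr_le0; case: lt1 => [slt|/im_subP HN].
    by rewrite leNgt; apply/negP => pos; nra.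
  have : (szj j0 H)%:R <= (szj j0 N)%:R :> R by rewrite ler_nat; exact: mxrankS.
  by nra.
- by apply/elP; exact: sub0mx.
- move=> M _ _; rewrite /excess /lam /szj mxrank0 subr0 subr_le0.
  rewrite (le_trans (dims M))// ler_sum// => j _.
  by rewrite mul0mx mxrank0 subr0.
Qed.

End RationalSpaces.

(** * Integer relations and rank *)

Section Combinations.
Variables (G : zmodType) (r : nat) (x : 'I_r -> G).

Definition comb (c : 'rV[int]_r) : G := \sum_i x i *~ c 0 i.

Lemma combD c d : comb (c + d) = comb c + comb d.
Proof. by rewrite -big_split /=; apply: eq_bigr => i _; rewrite mxE mulrzDr. Qed.

Lemma combZ (n : int) c : comb (n *: c) = comb c *~ n.
Proof.
rewrite /comb mulrz_suml; apply: eq_bigr => i _.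
by rewrite mxE mulrC mulrzA.
Qed.

Lemma comb0 : comb 0 = 0.
Proof. by rewrite /comb big1// => i _; rewrite mxE mulr0z. Qed.

Lemma combN c : comb (- c) = - comb c.
Proof. by rewrite -scaleN1r combZ mulrN1z. Qed.

Lemma lin_indep_comb : lin_indep x <-> forall c, comb c = 0 -> c = 0.
Proof.
split=> [indep c c0|indep c c0 i].
  by apply/rowP => i; rewrite mxE; exact: (indep (fun i => c 0 i)).
have /rowP/(_ i) : \row_k c k = 0.
  by apply: indep; rewrite -[RHS]c0; apply: eq_bigr => k _; rewrite mxE.
by rewrite !mxE.
Qed.

End Combinations.

Lemma comb_mul (G : zmodType) (n r : nat) (x : 'I_r -> G) (C : 'M[int]_(n, r))
    (a : 'rV[int]_n) :
  comb x (a *m C) = comb (fun k => comb x (row k C)) a.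
Proof.
rewrite mulmx_sum_row (big_morph _ (combD x) (comb0 x)).
by apply: eq_bigr => k _; rewrite combZ.
Qed.

Lemma raddf_comb (G W : zmodType) (f : {additive G -> W}) (r : nat)
    (x : 'I_r -> G) c : f (comb x c) = comb (fun i => f (x i)) c.
Proof. by rewrite raddf_sum; apply: eq_bigr => i _; rewrite raddfMz. Qed.

(** Adjoining [e] to an independent family of maximal length produces a
    relation, in which the coefficient of [e] cannot vanish. *)
Lemma exists_maximal_indep (G : zmodType) (E : seq G) :
  exists r (x : 'I_r -> G), [/\ lin_indep x, forall i, x i \in E &
    forall e, e \in E -> exists (N : int) c, N != 0 /\ e *~ N = comb x c].
Proof.
pose P r := `[< exists x : 'I_r -> G, lin_indep x /\ forall i, x i \in E >].
have P0 : exists r, P r.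
  by exists 0%N; apply/asboolP; exists (fun=> 0); split; [move=> c _ []|case].
have Ple r : P r -> (r <= size E)%N.
  move=> /asboolP[x [indep xE]].
  have injx : injective x.
    move=> i k xik; apply/eqP/negPn/negP => ik.
    pose c l : int := (l == i)%:Z - (l == k)%:Z.
    have /(_ i) : forall l, c l = 0.
      apply: indep; rewrite (bigD1 i)//= (bigD1 k)/= 1?eq_sym// big1.
        by rewrite /c !eqxx (negbTE ik) eq_sym (negbTE ik) xik !addr0 -mulrzDr.
      by move=> l /andP[/negbTE li /negbTE lk]; rewrite /c li lk.
    by rewrite /c eqxx (negbTE ik).
  rewrite -[r]size_enum_ord -(size_map x); apply: uniq_leq_size.
    by rewrite map_inj_uniq// enum_uniq.
  by move=> _ /mapP[i _ ->].
case: (ex_maxnP P0 Ple) => r /asboolP[x [indep xE]] max.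
exists r, x; split=> // e eE.
pose y (i : 'I_r.+1) := if unlift ord0 i is Some k then x k else e.
have y0 : y ord0 = e by rewrite /y unlift_none.
have yl k : y (lift ord0 k) = x k by rewrite /y liftK.
have /existsNP[c /not_implyP[]] : ~ lin_indep y.
  move=> indy; suff : (r.+1 <= r)%N by rewrite ltnn.
  apply: max; apply/asboolP; exists y; split=> // i.
  by rewrite /y; case: unliftP.
rewrite big_ord_recl y0 => c0 /existsNP[i ci].
exists (c ord0), (\row_k - c (lift ord0 k)); split.
  apply/eqP => cz; apply: ci.
  have cl k : c (lift ord0 k) = 0.
    move: k; apply: indep; rewrite -[RHS]c0 cz mulr0z add0r.
    by apply: eq_bigr => k _; rewrite yl.
  by case: (unliftP ord0 i) => [k|] ->.
apply/eqP; rewrite -subr_eq0 -[X in _ == X]c0 /comb -sumrN; apply/eqP.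
congr (_ + _); apply: eq_bigr => k _.
by rewrite mxE yl mulrNz opprK.
Qed.

Local Notation toQ := (map_mx (intr : int -> rat)).

Lemma toQ_inj (p n : nat) : injective (toQ : 'M[int]_(p, n) -> 'M[rat]_(p, n)).
Proof.
move=> C D /matrixP CD; apply/matrixP => i j; have := CD i j.
by rewrite !mxE => /intr_inj.
Qed.

Lemma clear_denominators (p n : nat) (A : 'M[rat]_(p, n)) :
  exists (N : int) (C : 'M[int]_(p, n)), N != 0 /\ N%:~R *: A = toQ C.
Proof.
pose den (k : 'I_p * 'I_n) := denq (A k.1 k.2).
exists (\prod_k den k).
exists (\matrix_(i, j) (numq (A i j) * \prod_(k | k != (i, j)) den k)); split.
  by apply/prodf_neq0 => k _; rewrite denq_eq0.
apply/matrixP => i j; rewrite !mxE (bigD1 (i, j))//= !intrM /den /=.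
rewrite mulrAC; congr (_ * _).
by rewrite -{2}(divq_num_den (A i j)) mulrC divfK// intr_eq0 denq_eq0.
Qed.

(** A matrix of maximal rank among those whose row space is contained in [S]. *)
Lemma subspace_matrix (r : nat) (S : set 'rV[rat]_r) : S 0 ->
  (forall v w, S v -> S w -> S (v + w)) -> (forall a v, S v -> S (a *: v)) ->
  exists K : 'M[rat]_r, forall w, S w <-> (w <= K)%MS.
Proof.
move=> S0 SD SZ.
pose P n := `[< exists K : 'M[rat]_r,
  (forall w : 'rV_r, (w <= K)%MS -> S w) /\ \rank K = n >].
have P0 : exists n, P n.
  exists 0%N; apply/asboolP; exists 0; rewrite mxrank0; split=> // w.
  by rewrite submx0 => /eqP->.
have Ple n : P n -> (n <= r)%N.
  by move=> /asboolP[K [_ <-]]; exact: rank_leq_row.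
case: (ex_maxnP P0 Ple) => n /asboolP[K [KS rK]] max.
exists K => w; split=> [Sw|]; last exact: KS.
apply/negPn/negP => wK; suff : (\rank (K + w)%MS <= n)%N.
  rewrite -rK leqNgt => /negP; apply; rewrite ltn_neqAle mxrankS ?addsmxSl//.
  rewrite (mxrank_leqif_sup (addsmxSl _ _)) andbT; apply/negP.
  by rewrite addsmx_sub (negbTE wK) andbF.
apply: max; apply/asboolP; exists (K + w)%MS; split=> // w'.
move=> /sub_addsmxP[[a b] /= ->]; apply: SD; first by apply: KS; exact: submxMl.
by rewrite [b]mx11_scalar mul_scalar_mx; exact: SZ.
Qed.

Section Relations.
Variables (G W : zmodType) (f : {additive G -> W}) (r : nat) (x : 'I_r -> G).

(** The rational span of the integer relations between the [f (x i)]. *)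
Definition relations : set 'rV[rat]_r := [set w | exists (N : int) c,
  [/\ N != 0, N%:~R *: w = toQ c & f (comb x c) = 0]].

Lemma relations_matrix :
  exists F : 'M[rat]_r, forall w, w *m F = 0 <-> relations w.
Proof.
have [|v w [N [c [N0 vc fc]]] [M [d [M0 wd fd]]]|a v [N [c [N0 vc fc]]]|K KP] :=
  @subspace_matrix r relations.
- by exists 1, 0; rewrite scaler0 map_mx0 comb0 raddf0.
- exists (N * M), (M *: c + N *: d); split; first by rewrite mulf_neq0.
    rewrite map_mxD !map_mxZ /= -vc -wd !scalerA scalerDr intrM.
    by rewrite [_ * N%:~R]mulrC.
  by rewrite combD !combZ raddfD !raddfMz fc fd !mul0rz addr0.
- exists (N * denq a), (numq a *: c); split.
  + by rewrite mulf_neq0 ?denq_eq0.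
  + rewrite map_mxZ /= -vc !scalerA intrM; congr (_ *: _).
    rewrite -mulrA -{2}[a]divq_num_den [X in _ * X]mulrC.
    by rewrite divfK ?intr_eq0 ?denq_eq0// mulrC.
  + by rewrite combZ raddfMz fc mul0rz.
exists (cokermx K) => w; rewrite KP submxE; split=> [->|/eqP//]; exact: eqxx.
Qed.

Variable R : realType.

(** The combinations of the [x i] whose integer coefficient vector lies in the
    row space of [U].  For independent [x] this is a subgroup of rank
    [\rank U]; it transfers the rank condition to subspaces. *)
Definition lattice_of (p : nat) (U : 'M[rat]_(p, r)) : set G :=
  [set comb x c | c in [set c | (toQ c <= U)%MS]].

Lemma lattice_of_subgroup (p : nat) (U : 'M[rat]_(p, r)) :
  is_subgroup (lattice_of U).
Proof.
apply/subgroupP; split.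
  by exists 0; rewrite ?comb0//= map_mx0 sub0mx.
move=> _ _ [c /= cU <-] [d /= dU <-]; exists (c - d).
  by rewrite /= map_mxB addmx_sub// eqmx_opp.
by rewrite combD combN.
Qed.

(** More than [\rank (U *m F)] elements of the image would have coordinate
    vectors that are dependent modulo the kernel of [F], that is, modulo the
    relations. *)
Lemma rank_lattice_le (p : nat) (U : 'M[rat]_(p, r)) (F : 'M[rat]_r) :
  (forall w, w *m F = 0 -> relations w) ->
  (rank R (f @` lattice_of U) <= (\rank (U *m F))%:R%:E)%E.
Proof.
move=> FP; apply: ge_ereal_sup => _ [n [y [yU indep]] <-].
rewrite lee_fin ler_nat.
have /choice[c cP] : forall k, exists c : 'rV[int]_r,
    (toQ c <= U)%MS /\ f (comb x c) = y k.
  by move=> k; have [_ [c cU <-] <-] := yU k; exists c.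
pose C : 'M[int]_(n, r) := \matrix_(k, i) c k 0 i.
have rowC k : row k C = c k by apply/rowP => i; rewrite !mxE.
have CU : (toQ C <= U)%MS.
  by apply/row_subP => k; rewrite -map_row rowC; case: (cP k).
apply: leq_trans (mxrankS (submxMr F CU)).
suff : row_free (toQ C *m F) by move=> /eqP->.
rewrite -kermx_eq0; apply/negPn/negP => /rowV0Pn[a /sub_kermxP aCF a0].
have [N [b [N0 Nab]]] := clear_denominators a.
have [M [d [M0 Md fd]]] : relations (toQ (b *m C)).
  by apply: FP; rewrite map_mxM -Nab -mulmxA -scalemxAl aCF scaler0.
have {}Md : d = M *: (b *m C) by apply: toQ_inj; rewrite -Md map_mxZ.
have : M *: b = 0.
  have /lin_indep_comb := indep; apply.
  rewrite -[RHS]fd Md scalemxAl comb_mul raddf_comb; apply: eq_bigr => k _.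
  by rewrite rowC; case: (cP k) => _ ->.
move=> Mb0; have b0 : b = 0.
  apply/rowP => k; move/rowP/(_ k): Mb0; rewrite !mxE => /eqP.
  by rewrite mulf_eq0 (negbTE M0) => /eqP.
move: Nab; rewrite b0 map_mx0 => /eqP; rewrite scaler_eq0 intr_eq0.
by rewrite (negbTE N0) (negbTE a0).
Qed.

(** A row basis of [U], multiplied by a common denominator. *)
Lemma rank_lattice_ge (p : nat) (U : 'M[rat]_(p, r)) : lin_indep x ->
  ((\rank U)%:R%:E <= rank R (lattice_of U))%E.
Proof.
move=> /lin_indep_comb indep; apply: ereal_sup_ubound; exists (\rank U) => //.
have [N [C [N0 NC]]] := clear_denominators (row_base U).
exists (fun k => comb x (row k C)); split.
  move=> k; exists (row k C) => //=; rewrite map_row -NC.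
  by rewrite (submx_trans (row_sub _ _))// scalemx_sub// eq_row_base.
apply/lin_indep_comb => a; rewrite -comb_mul => /indep /(congr1 toQ).
rewrite map_mxM -NC -scalemxAr map_mx0 => /eqP.
rewrite scaler_eq0 intr_eq0 (negbTE N0) mulmx_free_eq0 ?row_base_free//.
by rewrite -(map_mx0 (intr : int -> rat)) => /eqP /toQ_inj.
Qed.

End Relations.

(** If [H] is finite and [d] has order dividing [n] then the elements
    [h + d *+ k] with [h] in [H] and [k < n] form a finite group. *)
Lemma finite_torsion_subgroup (G : zmodType) (D : seq G) :
  (forall d, d \in D -> exists2 N : int, N != 0 & d *~ N = 0) ->
  exists H : set G, [/\ finite_set H, is_subgroup H & forall d, d \in D -> H d].
Proof.
elim: D => [_|d D IH tor].
  exists [set 0]; split=> //; apply/subgroupP; split=> // _ _ -> ->.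
  by rewrite /= subrr.
have [d' d'D|H [fH hH HD]] := IH; first by apply: tor; rewrite inE d'D orbT.
have [N N0 dN] := tor d (mem_head _ _).
pose n := `|N|%N; have n0 : (0 < n)%N by rewrite absz_gt0.
have dn : d *+ n = 0.
  move: dN; rewrite /n; case: (N) => k /=; first by rewrite pmulrn.
  by rewrite NegzE mulrNz => /eqP; rewrite oppr_eq0 => /eqP.
have [s [us sH _]] := set_card_seq fH.
pose t := [seq h + d *+ k | h <- s, k <- iota 0 n].
have tP y : y \in t <-> exists h (k : int), H h /\ y = h + d *~ k.
  split=> [/allpairsP[[h k] /= [/sH Hh _ ->]]|[h [k [/sH hs ->]]]].
    by exists h, k%:Z.
  have nz : n%:Z != 0 by case: (n) n0.
  apply/allpairsP; exists (h, `|(k %% n)%Z|%N); split=> //=.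
    by rewrite mem_iota add0n /= -ltz_nat gez0_abs ?modz_ge0// ltz_mod.
  congr (_ + _); rewrite pmulrn gez0_abs ?modz_ge0//.
  by rewrite {1}(divz_eq k n) mulrzDr mulrC mulrzA -pmulrn dn mul0rz add0r.
exists [set` t]; split; first exact: finite_seq.
  apply/subgroupP; split.
    by apply/tP; exists 0, 0; split; [exact: subgroup0|rewrite mulr0z addr0].
  move=> _ _ /tP[h [k [Hh ->]]] /tP[h' [k' [Hh' ->]]]; apply/tP.
  exists (h - h'), (k - k'); split; first exact: subgroupB.
  by rewrite mulrzBr opprD addrACA.
move=> d'; rewrite inE => /predU1P[->|/HD Hd']; apply/tP.
  by exists 0, 1; split; [exact: subgroup0|rewrite add0r].
by exists d', 0; rewrite mulr0z addr0.
Qed.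

(** * Arbitrary Abelian groups *)

Section AbelianGroups.
Variables (R : realType) (m : nat) (G : zmodType) (Gj : 'I_m -> zmodType).
Variable phi : forall j, {additive G -> Gj j}.

(** A maximal independent subfamily [x] of [E] gives rational coordinates [v]
    on [E].  The fibres of [v] are translates of subsets of a finite subgroup;
    its image lies in a rational vector space, where the maps [phi j] become
    the quotients by the relations between the [phi j (x i)]. *)
Theorem abelian_hbl_seq (s : 'I_m -> R) (A : R) (E : seq G) : (0 < m)%N ->
  in_unit_cube s ->
  (forall H : set G, is_subgroup H -> (rank R H < +oo)%E ->
    (rank R H <= \sum_(j < m) (s j)%:E * rank R (phi j @` H))%E) ->
  (forall H, is_subgroup H -> finite_set H -> (set_card H)%:R *
     \prod_(j < m) (set_card (phi j @` H))%:R `^ (- s j) <= A) ->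
  uniq E -> hbl_seq s E (fun j x => phi j x) A.
Proof.
move=> m0 s01 dims ratio uE.
have s0 j : 0 <= s j by case/andP: (s01 j).
have A0 : 0 <= A.
  have h : is_subgroup [set 0 : G].
    by apply/subgroupP; split=> // _ _ -> ->; rewrite /= subrr.
  apply: le_trans (ratio _ h (finite_set1 0)); apply: mulr_ge0 => //.
  by apply: prodr_ge0 => j _; exact: powR_ge0.
have [r [x [indep _ gen]]] := exists_maximal_indep E.
have /choice[F FP] : forall j, exists F : 'M[rat]_r,
    forall w, w *m F = 0 <-> relations (phi j) x w.
  by move=> j; exact: relations_matrix.
have /choice[v vP] : forall e, exists v : 'rV[rat]_r, e \in E ->
    exists (N : int) c, [/\ N != 0, e *~ N = comb x c & N%:~R *: v = toQ c].
  move=> e; have [eE|_] := boolP (e \in E); last by exists 0.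
  have [N [c [N0 ec]]] := gen e eE; exists (N%:~R^-1 *: toQ c) => _.
  by exists N, c; rewrite scalerA divff ?intr_eq0// scale1r.
have diff e e' : e \in E -> e' \in E -> exists (N : int) c,
    [/\ N != 0, (e - e') *~ N = comb x c & N%:~R *: (v e - v e') = toQ c].
  move=> /vP[N [c [N0 ec vc]]] /vP[M [d [M0 ed vd]]].
  exists (N * M), (M *: c - N *: d); split; first by rewrite mulf_neq0.
    rewrite combD combN !combZ -ec -ed mulrzBl mulrzA; congr (_ - _).
    by rewrite mulrC mulrzA.
  rewrite map_mxB !map_mxZ /= -vc -vd !scalerA scalerBr intrM.
  by rewrite [_ * N%:~R]mulrC.
rewrite -[A]mulr1.
apply: (hbl_seq_fibration (pi := v) (q := fun j w => w *m F j)) => //.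
- move=> j e e' eE e'E fe; apply/eqP; rewrite -subr_eq0 -mulmxBl; apply/eqP/FP.
  have [N [c [N0 ec vc]]] := diff _ _ eE e'E; exists N, c; split=> //.
  by rewrite -ec raddfMz raddfB fe subrr mul0rz.
- move=> _ /mapP[e0 e0E ->].
  set E0 := [seq e <- E | _].
  have [d /mapP[e]|H [fH hH HD]] :=
      @finite_torsion_subgroup G [seq e - e0 | e <- E0].
    rewrite mem_filter => /andP[/eqP ve eE] ->.
    have [N [c [N0 ec]]] := diff _ _ eE e0E; rewrite ve subrr scaler0 => vc.
    exists N => //; rewrite ec (_ : c = 0) ?comb0//.
    by apply: toQ_inj; rewrite -vc map_mx0.
  have fin := finite_subgroup_hbl m0 fH hH s01
    (fun M hM MH => ratio M hM (sub_finite_set MH fH)).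
  have sub0 : is_subgroup [set 0 : G].
    by apply/subgroupP; split=> // _ _ -> ->; rewrite /= subrr.
  apply: (hbl_seq_of_label (N := [set 0])) => //; first exact: filter_uniq.
  apply: (section_hbl_translate (x0 := e0) sub0 s0 A0 fin).
  + exact: filter_uniq.
  + by move=> e e' _ _ /= /eqP; rewrite subr_eq0 => /eqP.
  + by move=> e eE0; apply: HD; exact: (map_f (fun e => e - e0)).
apply: rational_hbl => //; last exact: undup_uniq.
move=> W; rewrite -lee_fin.
have latS := lattice_of_subgroup x W.
have fin : (rank R (lattice_of x W) < +oo)%E.
  have := @rank_lattice_le _ _ (idfun : {additive G -> G}) _ x R _ W 1%:M.
  rewrite image_id => le; apply: le_lt_trans (le _) (ltry _) => w.
  by rewrite mulmx1 => ->; exists 1, 0; rewrite scaler0 map_mx0 comb0.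
apply: le_trans (rank_lattice_ge R W indep) _.
apply: le_trans (dims _ latS fin) _.
rewrite -sumEFin; apply: lee_sum => j _; rewrite EFinM.
apply: lee_wpmul2l; first by rewrite lee_fin.
by apply: rank_lattice_le => w /FP.
Qed.

End AbelianGroups.

(** * Sums over infinite sets and norms *)

Section EsumNorms.
(* the point y0 makes the supremum norm nonnegative: a supremum over an empty
   type would be -oo *)
Variables (R : realType) (T : choiceType) (y0 : T).

Lemma esum_ge_seq (a : T -> R) (r : seq T) : uniq r -> (forall x, 0 <= a x) ->
  ((\sum_(x <- r) a x)%:E <= esum [set: T] (fun x => (a x)%:E))%E.
Proof.
move=> ur a0; apply: esum_ge; exists [set` r]; first by split=> //; exact: finite_seq.
by rewrite -fsbig_seq// sumEFin.
Qed.

Lemma esum_le_seq (a : T -> R) (b : R) :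
  (forall r, uniq r -> \sum_(x <- r) a x <= b) ->
  (esum [set: T] (fun x => (a x)%:E) <= b%:E)%E.
Proof.
move=> h; apply: ge_ereal_sup => _ [X [fX _] <-].
rewrite fsbig_finite// sumEFin lee_fin; apply: h; exact: finmap.fset_uniq.
Qed.

(** The passage from [f] to [v = f ^ (1/s)]; when [s = 0] the sup norm [k] of
    [f] is factored out instead. *)
Lemma lpnorm_powR_bound (s : R) (f : T -> R) : 0 <= s -> (forall y, 0 <= f y) ->
  (lpnorm (s%:E^-1)%E f < +oo)%E ->
  exists (b k : R) (v : T -> R), [/\ lpnorm (s%:E^-1)%E f = b%:E,
    0 <= k, forall y, 0 <= v y, forall y, f y <= k * v y `^ s &
    forall r, uniq r -> k * (\sum_(y <- r) v y) `^ s <= b].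
Proof.
move=> s0 f0; rewrite inver; have [->|sn0] := eqVneq s 0 => /= fin.
  set N := ereal_sup _ in fin *.
  have fN y : ((f y)%:E <= N)%E.
    by apply: ereal_sup_ubound; exists y => //; rewrite ger0_norm.
  have Nfin : N \is a fin_num.
    rewrite fin_numElt fin andbT; apply: lt_le_trans (fN y0); exact: ltNyr.
  have N0 : 0 <= fine N.
    by rewrite (le_trans (f0 y0))// -lee_fin fineK.
  exists (fine N), (fine N), (fun=> 1); split=> //.
  - by rewrite fineK.
  - by move=> y; rewrite powRr0 mulr1 -lee_fin fineK.
  - by move=> r _; rewrite powRr0 mulr1.
pose v y := `|f y| `^ s^-1; rewrite -/v in fin *.
have v0 y : 0 <= v y by exact: powR_ge0.
set S := esum _ _ in fin *.
have S0 : (0 <= S)%E by apply: esum_ge0 => y _; rewrite lee_fin powR_ge0.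
have Sfin : S \is a fin_num.
  rewrite ge0_fin_numE//; apply: lty_poweRy fin; by rewrite invrK.
exists (fine S `^ s), 1, v; split=> //.
- by rewrite invrK -(fineK Sfin) poweR_EFin.
- by move=> y; rewrite mul1r -powRrM mulVf// powRr1// ger0_norm.
- move=> r ur; rewrite mul1r; apply: ge0_ler_powR => //.
  + by rewrite nnegrE sumr_ge0.
  + by rewrite nnegrE fine_ge0.
  + by rewrite -lee_fin fineK//; exact: esum_ge_seq.
Qed.

Lemma lpnorm_indicator_le (s : R) (A : set T) : 0 <= s -> finite_set A ->
  (0 < set_card A)%N ->
  (lpnorm (s%:E^-1)%E (fun y => (y \in A)%:R : R) <=
   ((set_card A)%:R `^ s)%:E)%E.
Proof.
move=> s0 fA A0; rewrite inver; have [->|sn0] := eqVneq s 0 => /=.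
  rewrite powRr0; apply: ge_ereal_sup => _ [y _ <-]; rewrite lee_fin.
  by case: (y \in A); rewrite ?normr0 ?normr1 ?ler01.
rewrite invrK -poweR_EFin; apply: gt0_ler_poweR => //.
- rewrite in_itv /= leey andbT; apply: esum_ge0 => y _.
  by rewrite lee_fin powR_ge0.
- by rewrite in_itv /= leey andbT lee_fin.
apply: esum_le_seq => r ur.
rewrite (eq_bigr (fun y => if y \in A then 1 else 0)) => [|y _]; last first.
  case: (y \in A); rewrite ?normr1 ?powR1// normr0 powR0//.
  by rewrite invr_eq0.
rewrite -big_mkcond /= -big_filter big_const_seq count_predT iter_addr addr0.
rewrite ler_nat; apply: set_card_ge => //; first exact: filter_uniq.
by move=> x; rewrite mem_filter => /andP[/set_mem].
Qed.

End EsumNorms.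

Section OptimalConstant.
Variables (R : realType) (D : hbl_datum) (s : 'I_(hbl_size D) -> R).
Hypothesis s01 : in_unit_cube s.

Let s0 j : 0 <= s j. Proof. by case/andP: (s01 j). Qed.

Let im_gt0 (H : set (hbl_dom D)) j : is_subgroup H -> finite_set H ->
  (0 < set_card (hbl_map j @` H))%N.
Proof.
move=> hH fH; apply: set_card_subgroup_gt0; first exact: finite_image.
exact: subgroup_image.
Qed.

Lemma hbl_ratio_le (H : set (hbl_dom D)) (C : R) :
  is_subgroup H -> finite_set H ->
  (set_card H)%:R <= C *
    \prod_(j < hbl_size D) (set_card (hbl_map j @` H))%:R `^ s j ->
  hbl_ratio s H <= C.
Proof.
move=> hH fH; rewrite /hbl_ratio.
have P0 : 0 < \prod_(j < hbl_size D) (set_card (hbl_map j @` H))%:R `^ s j.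
  by apply: prodr_gt0 => j _; rewrite powR_gt0// ltr0n im_gt0.
by rewrite -ler_pdivrMr// -prodfV; under [X in _ -> _ * X <= _]eq_bigr do rewrite powRN.
Qed.

(** Write each [f j] as in [lpnorm_powR_bound]: the factors [k j] come out of
    the sum, and the remaining functions satisfy the inequality for finite
    families. *)
Lemma hbl_inequality_of_seq (A : R) : 0 <= A ->
  (forall E : seq (hbl_dom D), uniq E ->
    hbl_seq s E (fun j x => hbl_map j x) A) ->
  hbl_inequality s A%:E.
Proof.
move=> A0 hE f f0 fin.
have /choice[b /choice[k bk]] : forall j, exists b k, exists v : hbl_cod j -> R,
   [/\ lpnorm (hbl_exponent s j) (f j) = b%:E,
    0 <= k, forall y, 0 <= v y, forall y, f j y <= k * v y `^ s j &
    forall r, uniq r -> k * (\sum_(y <- r) v y) `^ s j <= b].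
  by move=> j; apply: lpnorm_powR_bound => //; exact: 0.
pose v j := sval (cid (bk j)).
have vP j : [/\ lpnorm (hbl_exponent s j) (f j) = (b j)%:E,
    0 <= k j, forall y, 0 <= v j y, forall y, f j y <= k j * v j y `^ s j &
    forall r, uniq r -> k j * (\sum_(y <- r) v j y) `^ s j <= b j].
  exact: svalP (cid (bk j)).
have -> : (\prod_(j < hbl_size D) lpnorm (hbl_exponent s j) (f j) =
           (\prod_(j < hbl_size D) b j)%R%:E)%E.
  by rewrite -prodEFin; apply: eq_bigr => j _; case: (vP j).
rewrite -EFinM; apply: esum_le_seq => E uE.
apply: (@le_trans _ _ ((\prod_(j < hbl_size D) k j) *
    \sum_(x <- E) \prod_(j < hbl_size D) v j (hbl_map j x) `^ s j)).
  rewrite mulr_sumr; apply: ler_sum => x _; rewrite -big_split /=.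
  by apply: ler_prod => j _; rewrite f0 /=; case: (vP j).
have k0 : 0 <= \prod_(j < hbl_size D) k j.
  by apply: prodr_ge0 => j _; case: (vP j).
apply: le_trans (ler_wpM2l k0 (hE E uE v _)) _.
  by move=> j y; case: (vP j).
rewrite mulrCA ler_wpM2l// -big_split /=; apply: ler_prod => j _.
case: (vP j) => _ kj vj _ h; rewrite h ?undup_uniq// andbT.
by rewrite mulr_ge0// powR_ge0.
Qed.

(** Testing on the indicator functions of the images of [H]. *)
Lemma hbl_ratio_le_constant (C : \bar R) (H : set (hbl_dom D)) : (0 <= C)%E ->
  hbl_inequality s C -> is_subgroup H -> finite_set H ->
  ((hbl_ratio s H)%:E <= C)%E.
Proof.
case: C => [c| |//] C0 ineq hH fH; last by rewrite leey.
rewrite lee_fin; apply: hbl_ratio_le => //.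
pose f j (y : hbl_cod j) : R := (y \in hbl_map j @` H)%:R.
have norm_le j : (lpnorm (hbl_exponent s j) (f j) <=
    ((set_card (hbl_map j @` H))%:R `^ s j)%:E)%E.
  by apply: lpnorm_indicator_le => //; [exact: finite_image|exact: im_gt0].
have f0 j y : 0 <= f j y by rewrite ler0n.
have := ineq f f0 (fun j => le_lt_trans (norm_le j) (ltry _)).
have [r [ur rH ->]] := set_card_seq fH.
have le1 : ((size r)%:R%:E <= esum [set: hbl_dom D]
    (fun x => (\prod_(j < hbl_size D) f j (hbl_map j x))%:E))%E.
  apply: le_trans (esum_ge_seq ur _) => [|x]; last by rewrite prodr_ge0.
  rewrite lee_fin big_seq (eq_bigr (fun=> 1)) => [|x /rH Hx].
    by rewrite -big_seq big_const_seq count_predT iter_addr addr0.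
  by rewrite big1// => j _; rewrite /f mem_set//; exists x.
move=> /(le_trans le1) le2; rewrite -lee_fin (le_trans le2)// EFinM.
apply: lee_wpmul2l => //; rewrite -prodEFin.
pose K (x y : \bar R) := (0 <= x)%E /\ (x <= y)%E.
have [] // : K (\prod_(j < hbl_size D) lpnorm (hbl_exponent s j) (f j))%E
  (\prod_(j < hbl_size D) ((set_card (hbl_map j @` H))%:R `^ s j)%:E)%E.
apply: big_ind2 => [|x1 x2 y1 y2 [x0 lex] [y0 ley]|j _]; split=> //.
- by rewrite mule_ge0.
- by apply: lee_pmul.
- rewrite /hbl_exponent inver; case: eqP => _ /=; last exact: poweR_ge0.
  apply: le_trans (ereal_sup_ubound _); last by exists 0.
  by rewrite lee_fin.
Qed.

End OptimalConstant.

(** * Growth of boxes *)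

Section Growth.
Variables (G : zmodType) (r : nat) (x : 'I_r -> G).

Definition box (N : nat) : set G :=
  range (fun n : {ffun 'I_r -> 'I_N} => \sum_i x i *+ n i).

Lemma set_card_box N : lin_indep x -> (N ^ r <= set_card (box N))%N.
Proof.
move=> indep; pose g (n : {ffun 'I_r -> 'I_N}) := \sum_i x i *+ n i.
have injg : injective g.
  move=> n n' e; apply/ffunP => i; apply/val_inj/eqP.
  rewrite -eqz_nat -subr_eq0; apply/eqP; move: i.
  apply: (indep (fun i => (n i)%:Z - (n' i)%:Z)).
  under eq_bigr do rewrite mulrzBr.
  by rewrite sumrB; apply/eqP; rewrite subr_eq0; apply/eqP.
rewrite -[N in (N ^ _)%N]card_ord -[r in (_ ^ r)%N]card_ord -card_ffun cardE.
rewrite -(size_map g); apply: set_card_ge.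
- exact/finite_image/finite_finset.
- by rewrite map_inj_uniq ?enum_uniq.
- by move=> _ /mapP[n _ ->]; exists n.
Qed.

(** If [y] is a maximal independent subfamily of the [f (x i)] then a common
    multiple [M] of the [f (x i)] lies in the span of [y].  Division of the
    coordinates by [M] puts the image of the box of side [N] into boundedly
    many translates of a box of side [O(N)] in the span of [y]. *)
Lemma set_card_image_box (W : zmodType) (f : {additive G -> W}) :
  exists k Q, (exists y : 'I_k -> W, lin_indep y /\
      forall l, exists i, y l = f (x i)) /\
    forall N, (0 < N)%N -> (set_card (f @` box N) <= Q * N ^ k)%N.
Proof.
have [k [y [indep yE gen]]] := exists_maximal_indep [seq f (x i) | i <- enum 'I_r].
have /choice[M0 /choice[c0 c0P]] : forall i, exists (M : int) c,
    M != 0 /\ f (x i) *~ M = comb y c.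
  by move=> i; apply: gen; apply/mapP; exists i; rewrite ?mem_enum.
pose M : nat := absz (\prod_i M0 i).
have M_gt0 : (0 < M)%N by rewrite absz_gt0; apply/prodf_neq0 => i _; case: (c0P i).
have /choice[c cP] : forall i, exists c, f (x i) *+ M = comb y c.
  move=> i; pose b := \prod_(i' | i' != i) M0 i'.
  have e : f (x i) *~ (\prod_i M0 i) = comb y (b *: c0 i).
    rewrite (bigD1 i)//= mulrzA combZ; congr (_ *~ _).
    by case: (c0P i).
  move: e; rewrite /M; case: (\prod_i _) => n e.
    by exists (b *: c0 i); rewrite -e pmulrn.
  by exists (- (b *: c0 i)); rewrite combN -e NegzE mulrNz opprK pmulrn.
pose B := (\sum_i \sum_l absz (c i 0%R l))%N.
exists k, ((2 * B).+1 ^ k * M ^ r)%N; split.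
  exists y; split=> // l; have /mapP[i _ ->] := yE l; by exists i.
move=> N N0.
pose g (t : {ffun 'I_k -> 'I_(2 * (N * B)).+1} * {ffun 'I_r -> 'I_M}) :=
  comb y (\row_l ((t.1 l)%:Z - (N * B)%:Z)) + \sum_i f (x i) *+ t.2 i.
have sub : f @` box N `<=` range g.
  move=> _ [_ [n _ <-] <-].
  pose a := \sum_i (n i %/ M)%N%:Z *: c i.
  have aB l : `|a 0 l| <= (N * B)%:Z.
    rewrite /a summxE; apply: le_trans (ler_norm_sum _ _ _) _.
    rewrite PoszM /B (big_morph Posz PoszD (erefl _)) mulr_sumr.
    apply: ler_sum => i _; rewrite mxE normrM; apply: ler_pM => //.
      by rewrite lez_nat (leq_trans (leq_div _ _))// ltnW.
    rewrite (big_morph Posz PoszD (erefl _)) (bigD1 l)//= abszE lerDl.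
    by rewrite sumr_ge0.
  pose p l := absz (a 0 l + (N * B)%:Z).
  have pE l : (p l)%:Z = a 0 l + (N * B)%:Z.
    by have := aB l; rewrite ler_norml /p; lia.
  have p_lt l : (p l < (2 * (N * B)).+1)%N.
    by have := aB l; rewrite ler_norml -ltz_nat pE; lia.
  exists ([ffun l => inord (p l)], [ffun i => Ordinal (ltn_pmod (n i) M_gt0)]) => //.
  rewrite /g /=.
  rewrite [X in comb y X](_ : _ = a); last first.
    by apply/rowP => l; rewrite !mxE ffunE inordK// pE addrK.
  rewrite /a (big_morph _ (combD y) (comb0 y)) -big_split raddf_sum /=.
  apply: eq_bigr => i _; rewrite combZ -cP ffunE /= raddfMn -pmulrn -mulrnA.
  by rewrite -mulrnDr mulnC -divn_eq.
apply: leq_trans (set_card_range_le sub) _.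
rewrite card_prod !card_ffun !card_ord mulnAC leq_mul2r -expnMn.
apply/orP; right; elim: (k) => // k' IH; rewrite !expnS leq_mul//; nia.
Qed.

End Growth.

(** Let [N] tend to infinity. *)
Lemma exponent_le (R : realType) (r : nat) (K sigma : R) :
  (forall N, (0 < N)%N -> (N ^ r)%:R <= K * N%:R `^ sigma) -> r%:R <= sigma.
Proof.
move=> h; rewrite leNgt; apply/negP => lt.
have delta : 0 < r%:R - sigma by rewrite subr_gt0.
have {}h N : (0 < N)%N -> N%:R `^ (r%:R - sigma) <= K.
  move=> N0; have Np : 0 < N%:R :> R by rewrite ltr0n.
  rewrite powRB ?gt_eqF ?implybT// ler_pdivrMr ?powR_gt0//.
  by rewrite powR_mulrn ?(ltW Np)// -natrX; exact: h.
have K1 : 1 <= K by have := h 1%N isT; rewrite powR1.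
have K0 : 0 <= K by exact: le_trans K1.
pose y := K `^ (r%:R - sigma)^-1.
have := h (Num.truncn y).+1 isT; apply/negP; rewrite -ltNge.
have -> : K = y `^ (r%:R - sigma) by rewrite -powRrM mulVf ?gt_eqF// powRr1.
apply: gt0_ltr_powR; rewrite ?nnegrE ?powR_ge0//.
by rewrite -truncn_lt_nat ?powR_ge0.
Qed.

(** Boxes spanned by independent elements of [H] grow like [N ^ r], while their
    images grow at most like the powers given by the ranks of the images. *)
Lemma rank_le_of_card_inequality (R : realType) (m : nat) (G : zmodType)
    (Gj : 'I_m -> zmodType) (phi : forall j, {additive G -> Gj j})
    (s : 'I_m -> R) (C : R) (H : set G) :
  in_unit_cube s ->
  (forall E : set G, finite_set E -> E !=set0 -> (set_card E)%:R <=
     C * \prod_(j < m) (set_card (phi j @` E))%:R `^ s j) ->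
  is_subgroup H ->
  (rank R H <= \sum_(j < m) (s j)%:E * rank R (phi j @` H))%E.
Proof.
move=> s01 card hH; apply: ge_ereal_sup => _ [r [x [xH indep]] <-].
have s0 j : 0 <= s j by case/andP: (s01 j).
have /choice[k /choice[Q kQ]] := fun j => set_card_image_box x (phi j).
apply: (@le_trans _ _ (\sum_(j < m) s j * (k j)%:R)%:E); last first.
  rewrite -sumEFin; apply: lee_sum => j _; rewrite EFinM.
  apply: lee_wpmul2l; first by rewrite lee_fin.
  have [[y [yindep yx]] _] := kQ j.
  apply: ereal_sup_ubound; exists (k j) => //; exists y; split=> // l.
  by have [i ->] := yx l; exists (x i).
rewrite lee_fin.
pose K := `|C| * \prod_(j < m) (Q j)%:R `^ s j.
apply: (@exponent_le R r K) => N N0.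
have box0 : box x N !=set0.
  by exists (\sum_i x i *+ [ffun=> Ordinal N0] i); exists [ffun=> Ordinal N0].
have fbox : finite_set (box x N) by exact/finite_image/finite_finset.
apply: le_trans (_ : (set_card (box x N))%:R <= _).
  by rewrite ler_nat; exact: set_card_box.
apply: le_trans (card _ fbox box0) _.
apply: (@le_trans _ _ (`|C| *
    \prod_(j < m) (set_card (phi j @` box x N))%:R `^ s j)).
  by rewrite ler_wpM2r ?ler_norm// prodr_ge0// => j _; exact: powR_ge0.
rewrite /K -mulrA ler_wpM2l//.
have -> : N%:R `^ (\sum_(j < m) s j * (k j)%:R) =
          \prod_(j < m) (N ^ k j)%:R `^ s j :> R.
  rewrite /powR gt_eqF ?ltr0n// mulr_suml expR_sum; apply: eq_bigr => j _.
  rewrite gt_eqF ?ltr0n ?expn_gt0 ?N0// natrX lnXn ?ltr0n//.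
  by rewrite -mulrA mulr_natl.
rewrite -big_split /=; apply: ler_prod => j _; rewrite powR_ge0 /=.
rewrite -powRM// -natrM; apply: ge0_ler_powR => //; rewrite ?nnegrE//.
by rewrite ler_nat; have [_] := kQ j; apply.
Qed.

Theorem theorem1p2 (R : realType) (D : hbl_datum) :
  (forall s : 'I_(hbl_size D) -> R, hbl_P s -> hbl_B s = hbl_A s) /\
  (forall s : 'I_(hbl_size D) -> R, in_unit_cube s ->
   forall C : R,
     (forall E : set (hbl_dom D), finite_set E -> E !=set0 ->
        (set_card E)%:R <=
        C * \prod_(j < hbl_size D) (set_card (hbl_map j @` E))%:R `^ s j) ->
     hbl_P s /\ (hbl_A s <= C%:E)%E).
Proof.
split=> [s [s01 dims]|s s01 C card]; last first.
  split; first by split=> // H hH _; exact: rank_le_of_card_inequality card hH.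
  apply: ge_ereal_sup => _ [H [hH fH] <-]; rewrite lee_fin.
  by apply: hbl_ratio_le => //; apply: card => //; exists 0; exact: subgroup0.
apply/eqP; rewrite eq_le; apply/andP; split; last first.
  apply: le_ereal_inf_tmp => C [C0 ineq]; apply: ge_ereal_sup => _ [H [hH fH] <-].
  exact: hbl_ratio_le_constant.
have ratio (H : set (hbl_dom D)) : is_subgroup H -> finite_set H ->
    ((hbl_ratio s H)%:E <= hbl_A s)%E.
  by move=> hH fH; apply: ereal_sup_ubound; exists H.
have A0 : (0 <= hbl_A s)%E.
  have h0 : is_subgroup [set 0 : hbl_dom D].
    by apply/subgroupP; split=> // _ _ -> ->; rewrite /= subrr.
  apply: le_trans (ratio _ h0 (finite_set1 0)); rewrite lee_fin.
  by apply: mulr_ge0 => //; apply: prodr_ge0 => j _; exact: powR_ge0.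
case: (hbl_A s) A0 ratio => [A| |//] A0 ratio; last by rewrite leey.
apply: ereal_inf_lbound; split=> //; apply: hbl_inequality_of_seq => // E uE.
by apply: abelian_hbl_seq => //; exact: hbl_size_gt0.
Qed.
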